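(* Let $\{w_i\}_{i=1}^n$ be a basis of $\mathbb{R}^n$ and let $(S_1,\dots,S_m)$ form a uniform cover of $[n]$ with weights $(p_1,\dots,p_m)$. Let $\widetilde{H}_j=\mathrm{span}\{w_k : k\notin S_j\}$ and $p=\sum_{j=1}^m p_j$. Put $$BL_1:=\frac{\prod_{j=1}^m|\wedge_{k\in[n]\setminus S_j}w_k|^{p_j}}{|\wedge_{i=1}^n w_i|^{p-1}}.$$ Then for any integrable functions $f_j:\widetilde{H}_j^\perp\to[0,\infty)$, $1\leqslant j\leqslant m$, $$\int_{\mathbb{R}^n}\prod_{j=1}^m f_j^{p_j}(P_{\widetilde{H}_j^\perp}x)\,dx\leqslant BL_1\prod_{j=1}^m\left(\int_{\widetilde{H}_j^\perp}f_j(x)\,dx\right)^{p_j}.$$ Moreover, for every integrable $f:\mathbb{R}^n\to[0,\infty)$ and integrable $f_j:\widetilde{H}_j^\perp\to[0,\infty)$, $1\leqslant j\leqslant m$, such that $f(x)\geqslant\prod_{j=1}^m f_j^{p_j}(x_j)$ whenever $x=\sum_{j=1}^m p_jx_j$ for some $x_j\in\widetilde{H}_j^\perp$, we have $$\int_{\mathbb{R}^n}f(x)\,dx\geqslant\frac{1}{BL_1}\prod_{j=1}^m\left(\int_{\widetilde{H}_j^\perp}f_j(x)\,dx\right)^{p_j}.$$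
   Context: $[n]=\{1,\dots,n\}$. For $m\geqslant1$, subsets $S_1,\dots,S_m\subseteq[n]$ (not necessarily distinct) form a uniform cover of $[n]$ with weights $(p_1,\dots,p_m)$, $p_j>0$ for all $j$, if $\sum_{j=1}^m p_j\chi_{S_j}(i)=1$ for every $i\in[n]$. For vectors $u_1,\dots,u_k$, $|\wedge_{i=1}^k u_i|$ is the $k$-dimensional volume of the parallelepiped they span (equal to $1$ for the empty family). $P_F$ is the orthogonal projection onto the linear subspace $F$ of $\mathbb{R}^n$ and $F^\perp$ its orthogonal complement. Integrals over a subspace are with respect to its Lebesgue measure (unit point mass on $\{0\}$). *)

(* Defs.v *)
From HB Require Import structures.
From mathcomp Require Import all_boot all_order all_algebra.
From mathcomp Require Import all_classical all_reals all_analysis.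
Import numFieldNormedType.Exports.

Set Implicit Arguments.
Unset Strict Implicit.
Unset Printing Implicit Defensive.

Import Order.TTheory GRing.Theory Num.Theory.
Local Open Scope classical_set_scope.
Local Open Scope ring_scope.

(* The Euclidean space R^n is 'rV[R]_n, linear subspaces are {vspace 'rV[R]_n}
   and the points of a subspace F form the type subvs_of F. *)

Section euclidean_structure.
Context {R : realType} {n : nat}.
Implicit Types (u v x : 'rV[R]_n) (F : {vspace 'rV[R]_n}) (s : seq 'rV[R]_n).

Definition dotv u v : R := \sum_(i < n) u 0 i * v 0 i.

Let dotv_bilinear : bilinear_for
  (GRing.Scale.Law.clone _ _ *%R _) (GRing.Scale.Law.clone _ _ (idfun \; *%R) _)
  dotv.
Proof.
split => [v|u] a x y /=; rewrite /dotv mulr_sumr -big_split /=;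
  apply: eq_bigr => i _; rewrite !mxE.
- by rewrite mulrDl mulrA.
- by rewrite mulrDr mulrCA.
Qed.

HB.instance Definition _ := bilinear_isBilinear.Build R
  'rV[R]_n 'rV[R]_n R _ _ dotv dotv_bilinear.

Let dotv_sym u v : dotv u v = (-1) ^+ false * idfun (dotv v u).
Proof. by rewrite expr0 mul1r; apply: eq_bigr => i _; rewrite mulrC. Qed.

HB.instance Definition _ := isHermitianSesquilinear.Build R
  'rV[R]_n false idfun dotv dotv_sym.

Let dotv_gt0 u : u != 0 -> 0 < dotv u u.
Proof.
move=> u0; suff /existsP[i ui0] : [exists i, u 0 i != 0].
  rewrite /dotv (bigD1 i)//= ltr_wpDr//.
    by apply: sumr_ge0 => j _; rewrite -expr2 sqr_ge0.
  by rewrite -expr2 exprn_even_gt0.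
apply: contraNT u0; rewrite negb_exists => /forallP uNN0.
by apply/eqP/rowP => j; rewrite mxE; apply/eqP; rewrite -[_ == _]negbK uNN0.
Qed.

HB.instance Definition _ := isDotProduct.Build R 'rV[R]_n dotv dotv_gt0.

Definition orth F : {vspace 'rV[R]_n} := orthov dotv F.

Definition is_onb s F : Prop := orthonormal dotv s /\ span s = F.

Lemma dotv_orthonormal s x y : orthonormal dotv s -> y \in s ->
  dotv (\sum_(e <- s) dotv x e *: e) y = dotv x y.
Proof.
elim: s => // e s IH; rewrite /orthonormal /= => /and3P[/andP[/eqP e1 s1]].
rewrite /ortho_rec /= andbT => /allP es os; rewrite inE big_cons.
have lD u v w : dotv (u + v) w = dotv u w + dotv v w.
  exact: (linearDl (dotv : {bilinear _ -> _ -> _ | _ & _})).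
have lZ a u v : dotv (a *: u) v = a * dotv u v.
  exact: (linearZl_LR (dotv : {bilinear _ -> _ -> _ | _ & _})).
have l0 u : dotv 0 u = 0 by apply: big1 => i _; rewrite mxE mul0r.
rewrite lD lZ => /predU1P[->|ys].
  rewrite e1 mulr1 big_seq (big_ind (fun v => dotv v e = 0)) ?addr0//.
  - by move=> u v u0 v0; rewrite lD u0 v0 addr0.
  - by move=> u us; rewrite lZ (dotv_sym u) expr0 mul1r /= (eqP (es _ us)) mulr0.
by rewrite (eqP (es _ ys)) mulr0 add0r IH// /orthonormal s1.
Qed.

Lemma onb_exists F : exists s, is_onb s F.
Proof.
suff H X : exists s, orthonormal dotv s /\ span s = span X.
  by have [s []] := H (vbasis F); rewrite (span_basis (vbasisP F)); exists s.
elim: X => [|x X [s [os sX]]]; first by exists [::].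
pose y := \sum_(e <- s) dotv x e *: e.
have ys : y \in span s.
  by rewrite /y big_seq memv_suml// => e es; rewrite memvZ// memv_span.
have dsub u v w : dotv (u - v) w = dotv u w - dotv v w.
  exact: (linearBl (dotv : {bilinear _ -> _ -> _ | _ & _})).
have dZl a u v : dotv (a *: u) v = a * dotv u v.
  exact: (linearZl_LR (dotv : {bilinear _ -> _ -> _ | _ & _})).
have dZr a u v : dotv u (a *: v) = a * dotv u v.
  by rewrite dotv_sym expr0 mul1r /= dZl (dotv_sym v) expr0 mul1r.
pose z := x - y; have xE : x = z + y by rewrite subrK.
have [z0|z0] := eqVneq z 0.
  exists s; split => //; rewrite span_cons -sX; apply/esym/addv_idPr.
  by rewrite xE z0 add0r -memvE.
have zz := dotv_gt0 z0.
pose e := (Num.sqrt (dotv z z))^-1 *: z.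
have c0 : (Num.sqrt (dotv z z))^-1 != 0 by rewrite invr_neq0// sqrtr_eq0 -ltNge.
exists (e :: s); split.
  move: (os); rewrite /orthonormal /= => /andP[-> ->]; rewrite !andbT.
  apply/andP; split.
    rewrite dZl dZr mulrA -expr2 exprVn sqr_sqrtr ?ltW// mulVf//.
    by rewrite gt_eqF.
  apply/allP => w ws /=.
  by rewrite dZl (dsub x y w) /y dotv_orthonormal// subrr mulr0.
rewrite !span_cons -sX.
apply/eqP; rewrite eqEsubv !subv_add !addvSr !andbT -!memvE; apply/andP; split.
- by rewrite memvZ// memvB ?(subvP (addvSr _ _) _ ys)// memvE addvSl.
- rewrite xE memvD ?(subvP (addvSr _ _) _ ys)//; apply: (subvP (addvSl _ _)).
  by apply/vlineP; exists (Num.sqrt (dotv z z)); rewrite scalerA divff ?scale1r// -invr_eq0.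
Qed.

Definition onb F : seq 'rV[R]_n := projT1 (cid (onb_exists F)).

Lemma onbP F : is_onb (onb F) F.
Proof. exact: projT2 (cid (onb_exists F)). Qed.

Definition orthproj F x : subvs_of F := vsproj F (daddv_pi F (orth F) x).

Lemma cap_orth F : (F :&: orth F = 0)%VS.
Proof.
apply/eqP; rewrite -subv0; apply/subvP => u; rewrite memv_cap => /andP[uF].
move=> /mem_orthovP/(_ _ uF) uu; rewrite memv0; apply/negPn/negP => /dotv_gt0.
by rewrite uu ltxx.
Qed.

Let onb_comp F x := \sum_(e <- onb F) dotv x e *: e.

Let onb_comp_mem F x : onb_comp F x \in F.
Proof.
suff : onb_comp F x \in span (onb F) by have [_ ->] := onbP F.
by rewrite /onb_comp big_seq memv_suml// => e es; rewrite memvZ// memv_span.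
Qed.

Let sub_onb_comp F x : x - onb_comp F x \in orth F.
Proof.
have [os sF] := onbP F.
rewrite /orth mem_orthov_sym -[X in (X <= _)%VS]sF; apply/span_subvP => e es.
rewrite mem_orthov1 herm_eq0C /=.
rewrite (linearBl (dotv : {bilinear _ -> _ -> _ | _ & _})).
by rewrite /= /onb_comp dotv_orthonormal// subrr.
Qed.

Lemma orthproj_orth F x : x - vsval (orthproj F x) \in orth F.
Proof.
have xFF : x \in (F + orth F)%VS.
  by rewrite -(subrK (onb_comp F x) x) addrC memv_add.
rewrite /orthproj vsprojK ?memv_pi//.
by rewrite -{1}(daddv_pi_add (cap_orth F) xFF) addrAC subrr add0r memv_pi.
Qed.

Lemma onb_expand F x : x \in F -> x = \sum_(e <- onb F) dotv x e *: e.
Proof.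
move=> xF; apply/eqP; rewrite -subr_eq0 -memv0 -(cap_orth F) memv_cap.
by apply/andP; split; [exact: memvB xF (onb_comp_mem F x)|exact: sub_onb_comp].
Qed.

Let dotv_nth s (i j : nat) : orthonormal dotv s ->
  (i < size s)%N -> (j < size s)%N -> dotv s`_i s`_j = (i == j)%:R.
Proof.
elim: s i j => // e s IH i j; rewrite /orthonormal /=.
move=> /and3P[/andP[/eqP e1 s1]]; rewrite /ortho_rec /= andbT => /allP es os.
have os' : orthonormal dotv s by rewrite /orthonormal s1.
case: i j => [|i] [|j]//=; rewrite ?ltnS => ilt jlt.
- exact/eqP/es/mem_nth.
- by rewrite dotv_sym expr0 mul1r /=; apply/eqP/es/mem_nth.
- by rewrite IH.
Qed.

Lemma dotv_onb F (i j : 'I_(size (onb F))) :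
  dotv (onb F)`_i (onb F)`_j = (i == j)%:R.
Proof. by rewrite dotv_nth//; have [] := onbP F. Qed.

End euclidean_structure.

(* Lebesgue measure on Borel subsets of R^k, as a k-fold product measure;
   for k = 0 it is the unit mass at the only point. *)
Section lebesgue_tuple.
Context {R : realType}.
Local Open Scope ereal_scope.
Local Notation T k := (k.-tuple (measurableTypeR R)).

Definition tuple_cons k (x : measurableTypeR R * T k) : T k.+1 :=
  [tuple of x.1 :: x.2].

Let measurable_tuple_cons k : measurable_fun setT (@tuple_cons k).
Proof. exact: measurable_cons. Qed.

Section step.
Context (k : nat) (mu : {sigma_finite_measure set (T k) -> \bar R}).

Definition lebesgue_tuple_step : set (T k.+1) -> \bar R :=
  pushforward (lebesgue_measure \x mu) (@tuple_cons k).

HB.instance Definition _ := Measure.copy lebesgue_tuple_step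
  (measure_function_pushforward__canonical__measure_function_Measure
     (lebesgue_measure \x mu) (@measurable_tuple_cons k)).

Let sigma_finite_step : sigma_finite setT lebesgue_tuple_step.
Proof.
have /sigma_finiteP[F [TF ndF Foo]] := sigma_finiteT (@lebesgue_measure R).
have /sigma_finiteP[G [TG ndG Goo]] := sigma_finiteT mu.
pose split_tuple (t : T k.+1) : measurableTypeR R * T k :=
  (thead t, [tuple of behead t]).
exists (fun i => split_tuple @^-1` (F i `*` G i)).
  rewrite -preimage_bigcup; apply/esym; rewrite -subTset => t _.
  have [n _ Fn] : (\bigcup_i F i) (split_tuple t).1 by rewrite -TF.
  have [m _ Gm] : (\bigcup_i G i) (split_tuple t).2 by rewrite -TG.
  exists (maxn n m) => //; split => /=.
  - by move: Fn; exact/subsetPset/ndF/leq_maxl.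
  - by move: Gm; exact/subsetPset/ndG/leq_maxr.
move=> i; have [mF Fi] := Foo i; have [mG Gi] := Goo i; split.
  suff ms : measurable_fun setT split_tuple.
    by rewrite -[X in measurable X]setTI; apply: ms => //; exact: measurableX.
  apply/measurable_fun_pairP; split => /=.
    exact: measurable_tnth.
  exact: measurable_behead.
rewrite /lebesgue_tuple_step /pushforward -comp_preimage.
rewrite (_ : _ \o _ = id) ?preimage_id.
  by rewrite product_measure1E// lte_mul_pinfty// ge0_fin_numE.
apply/funext => -[x t]; rewrite /split_tuple /= theadE.
by congr (_, _); exact/val_inj.
Qed.

HB.instance Definition _ := Measure_isSigmaFinite.Build _ _ _
  lebesgue_tuple_step sigma_finite_step.

End step.

Fixpoint lebesgue_tuple k : {sigma_finite_measure set (T k) -> \bar R} :=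
  if k is k'.+1 then lebesgue_tuple_step (lebesgue_tuple k')
  else \d_ ([tuple] : T 0).

End lebesgue_tuple.

(* The (completed) Lebesgue measure carried to T by a bijection h from R^k to T.
   Its sigma-algebra consists of the Caratheodory-measurable sets, that is, of
   the Lebesgue-measurable ones and not only of the Borel ones. *)
Section lebesgue_image.
Context {R : realType} {k : nat} {T : pointedType} (h : k.-tuple R -> T).
Local Open Scope ereal_scope.

Definition lebesgue_image_outer (A : set T) : \bar R :=
  mu_ext (lebesgue_tuple k) (h @^-1` A).

Let outer0 : lebesgue_image_outer set0 = 0.
Proof. by rewrite /lebesgue_image_outer preimage_set0 mu_ext0. Qed.

Let outer_ge0 A : 0 <= lebesgue_image_outer A.
Proof. exact: mu_ext_ge0. Qed.

Let le_outer : {homo lebesgue_image_outer : A B / A `<=` B >-> A <= B}.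
Proof. by move=> A B AB; apply: le_mu_ext; exact: preimage_subset. Qed.

Let outer_sigma_subadditive : sigma_subadditive lebesgue_image_outer.
Proof.
move=> A; rewrite /lebesgue_image_outer preimage_bigcup.
exact: mu_ext_sigma_subadditive.
Qed.

HB.instance Definition _ := isOuterMeasure.Build R T lebesgue_image_outer
  outer0 outer_ge0 le_outer outer_sigma_subadditive.

Let I : measurableType _ := caratheodory_type lebesgue_image_outer.

Definition lebesgue_image : set I -> \bar R := lebesgue_image_outer.

Let measure0 : lebesgue_image set0 = 0. Proof. exact: outer0. Qed.

Let measure_ge0 (A : set I) : 0 <= lebesgue_image A.
Proof. exact: outer_ge0. Qed.

Let measure_semi_sigma_additive : semi_sigma_additive lebesgue_image.
Proof.
exact: (@caratheodory_measure_sigma_additive R T lebesgue_image_outer).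
Qed.

HB.instance Definition _ := isMeasure.Build _ _ _ lebesgue_image
  measure0 measure_ge0 measure_semi_sigma_additive.

End lebesgue_image.
Arguments lebesgue_image {R k T} h.

HB.instance Definition _ (R : realType) n (F : {vspace 'rV[R]_n}) :=
  isPointed.Build (subvs_of F) 0.

Section lebesgue_euclidean.
Context {R : realType} {n : nat}.

Definition row_of_tuple (t : n.-tuple R) : 'rV[R]_n := \row_i tnth t i.

Definition lebesgue_rV := lebesgue_image row_of_tuple.

HB.instance Definition _ := Measure.on lebesgue_rV.

Context (F : {vspace 'rV[R]_n}).

Definition onb_comb (t : (size (onb F)).-tuple R) : subvs_of F :=
  vsproj F (\sum_i tnth t i *: (onb F)`_i).

Let val_onb_comb t : vsval (onb_comb t) = \sum_i tnth t i *: (onb F)`_i.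
Proof.
rewrite vsprojK//; suff : \sum_i tnth t i *: (onb F)`_i \in span (onb F).
  by have [_ ->] := onbP F.
by rewrite memv_suml// => i _; rewrite memvZ// memv_span// mem_nth.
Qed.

Lemma dotv_onb_comb t u : dotv (vsval (onb_comb t)) (vsval (onb_comb u)) =
  \sum_i tnth t i * tnth u i.
Proof.
rewrite !val_onb_comb (linear_sumlz (dotv : {bilinear _ -> _ -> _ | _ & _})) /=.
apply: eq_bigr => i _.
rewrite (linear_sumr (dotv : {bilinear _ -> _ -> _ | _ & _})) /=.
rewrite (bigD1 i)//= big1 ?addr0 => [|j ji].
  rewrite (linearZl_LR (dotv : {bilinear _ -> _ -> _ | _ & _})).
  rewrite /= (linearZr_LR (dotv : {bilinear _ -> _ -> _ | _ & _})).
  by rewrite /= dotv_onb eqxx mulr1.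
rewrite (linearZl_LR (dotv : {bilinear _ -> _ -> _ | _ & _})).
rewrite /= (linearZr_LR (dotv : {bilinear _ -> _ -> _ | _ & _})).
by rewrite /= dotv_onb eq_sym (negbTE ji) !mulr0.
Qed.

Lemma onb_comb_surj (v : subvs_of F) : exists t, onb_comb t = v.
Proof.
exists [tuple dotv (vsval v) (onb F)`_i | i < size (onb F)].
apply: val_inj; rewrite /= val_onb_comb [RHS](onb_expand (subvsP v)).
rewrite (big_nth 0) big_mkord.
by apply: eq_bigr => i _; rewrite tnth_mktuple.
Qed.

(* By dotv_onb_comb and onb_comb_surj, onb_comb is an isometry from R^(dim F)
   onto F. *)
Definition lebesgue_subspace := lebesgue_image onb_comb.

HB.instance Definition _ := Measure.on lebesgue_subspace.

End lebesgue_euclidean.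
Arguments lebesgue_rV R n : clear implicits.

Arguments lebesgue_subspace {R n} F.

Section wedge.
Context {R : realType} {n : nat} (s : seq 'rV[R]_n).

Definition parallelepiped : set (subvs_of (span s)) :=
  [set v | exists2 t : 'I_(size s) -> R, (forall i, 0 <= t i <= 1) &
    vsval v = \sum_i t i *: s`_i].

(* size s is the dimension of span s exactly when s is free; otherwise the
   parallelepiped is degenerate. *)
Definition wedge : R :=
  if free s then fine (lebesgue_subspace (span s) parallelepiped) else 0.

End wedge.

Lemma wedge_nil (R : realType) (n : nat) : wedge ([::] : seq 'rV[R]_n) = 1.
Proof.
rewrite /wedge nil_free /lebesgue_subspace /lebesgue_image /lebesgue_image_outer.
rewrite (_ : _ @^-1` _ = setT).
  have : size (onb (span ([::] : seq 'rV[R]_n))) = 0%N.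
    have [os ss] := onbP (span ([::] : seq 'rV[R]_n)).
    case E : (onb _) => [//|e s]; have := orthonormal_not0 os.
    have : e \in span ([::] : seq 'rV[R]_n).
      by rewrite -ss memv_span// E mem_head.
    by rewrite E span_nil memv0 => /eqP ->; rewrite mem_head.
  move: (size _) => k ->; rewrite measurable_mu_extE//.
  by transitivity (fine (1%E : \bar R)) => //; congr fine; exact: diracT.
rewrite -subTset => t _; exists (fun=> 0); first by case.
by rewrite big_ord0; apply/eqP; rewrite -memv0 -span_nil subvsP.
Qed.

Definition uniform_cover (R : realType) (n m : nat)
    (S : 'I_m -> {set 'I_n}) (p : 'I_m -> R) : Prop :=
  (forall j, 0 < p j) /\
  (forall i, \sum_(j < m) p j * (i \in S j)%:R = 1).

Section BL.
Context {R : realType} {n m : nat} (w : 'I_n -> 'rV[R]_n)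
  (S : 'I_m -> {set 'I_n}) (p : 'I_m -> R).

Definition outside (j : 'I_m) : seq 'rV[R]_n := [seq w k | k in ~: S j].

Definition Htilde (j : 'I_m) : {vspace 'rV[R]_n} := span (outside j).

Definition BL1 : R :=
  (\prod_(j < m) wedge (outside j) `^ p j) /
  wedge [seq w i | i : 'I_n] `^ ((\sum_(j < m) p j) - 1).

End BL.

(* Main.v *)
Require Import Defs.
From HB Require Import structures.
From mathcomp Require Import all_boot all_order all_algebra.
From mathcomp Require Import ring lra.
From mathcomp Require Import all_classical all_reals all_analysis.
From mathcomp Require Import measurable_realfun.
Import numFieldNormedType.Exports.
Set Implicit Arguments.
Unset Strict Implicit.
Unset Printing Implicit Defensive.
Import Order.TTheory GRing.Theory Num.Theory.
Local Open Scope classical_set_scope.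
Local Open Scope ring_scope.

(** Let W be the matrix with rows w_i and let v_i be the basis dual to w_i. A
vector is orthogonal to the w_k with k outside S_j exactly when it is a
combination of the v_k with k in S_j. Hence, for x = sum_i s_i w_i, the
projection of x that enters the j-th factor of the first integrand depends only
on the coordinates s_k with k in S_j, and in the second inequality the points of
the j-th subspace are given by their coordinates on the v_k with k in S_j. After
these linear changes of variables both inequalities concern functions G_j on
R^n that only see the coordinates in S_j, and both hold with constant 1:

- the integral of prod_j G_j^p_j is at most prod_j (int G_j)^p_j
  ([finner_inequality]);
- if H(sum_j p_j y_j) >= prod_j G_j(y_j)^p_j for all y_j supported in S_j, then
  the integral of H is at least prod_j (int G_j)^p_j ([barthe_inequality]).

Each is proved by integrating out one coordinate at a time. For a given
coordinate the weights of the S_j that contain it sum to 1, so a single step is,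
respectively, Hoelder's inequality [lee_holder] and the one-dimensional
Prekopa-Leindler inequality [prekopa_leindler] for finitely many functions. The
latter follows from the Brunn-Minkowski inequality on the line
([brunn_minkowski]) applied to superlevel sets of functions of maximum 1,
integrated over the levels ([layer_cake]), and the weighted arithmetic-geometric
mean inequality ([lee_amgm]).

The constant comes from the Jacobians. A linear map M scales the Lebesgue
measure by |det M| ([integral_tuple_affine]), so a volume |u_1 /\ ... /\ u_k|
is the square root of the Gram determinant ([wedgeE]). Let c_j be the volume
spanned by the projections of the w_k with k in S_j. The product of c_j and the
volume spanned by the remaining w_k is |det W|, and the volume spanned by the
v_k with k in S_j, which form the basis dual to those projections, is 1 / c_j
([gram_complement], [frame_determinants]). Collecting powers gives BL_1 in both
inequalities.

The given functions are measurable only for the completed sigma-algebra, whereas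
Fubini's theorem is used for Borel functions. By [borel_sandwich] each of them
lies between two Borel functions with the same integral: the upper inequality
uses the majorants of the f_j, the lower one the minorants of the g_j and the
majorant of f. The majorants may take the value +oo on a null set, and for this
reason all functions in the Borel part have values in the extended reals. *)

(** * Weighted means and the Hoelder inequality *)

Section measurability.
Local Open Scope ereal_scope.
Context d (T : measurableType d) (R : realType).

Lemma measurable_poweR_comp (f : T -> \bar R) (r : R) :
  measurable_fun [set: T] f -> measurable_fun [set: T] (fun x => f x `^ r).
Proof. by move=> mf; exact: (measurableT_comp (measurable_poweR r) mf). Qed.

Lemma measurable_prode (I : finType) (c : pred I) (f : I -> T -> \bar R) :
  (forall j, measurable_fun [set: T] (f j)) ->
  measurable_fun [set: T] (fun x => \prod_(j | c j) f j x).
Proof.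
move=> mf; suff: forall s : seq I,
    measurable_fun [set: T] (fun x => \prod_(j <- s | c j) f j x) by [].
elim=> [|j s IH]; first by under eq_fun do rewrite big_nil; exact: measurable_cst.
under eq_fun => x do rewrite big_cons.
by case: (c j) => //; exact: emeasurable_funM.
Qed.
End measurability.

Section amgm.
Context {R : realType} {I : finType} (c : pred I) (p : I -> R).
Hypothesis p_gt0 : forall j, 0 < p j.
Hypothesis p_sum1 : \sum_(j | c j) p j = 1.

(** By concavity of the logarithm: with a the weighted mean,
ln x_j <= ln a + (x_j / a - 1), and the last terms average to 0. *)
Lemma amgm (x : I -> R) : (forall j, c j -> 0 <= x j) ->
  \prod_(j | c j) x j `^ p j <= \sum_(j | c j) p j * x j.
Proof.
move=> x0.
have s0 : 0 <= \sum_(j | c j) p j * x j.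
  by apply: sumr_ge0 => j cj; rewrite mulr_ge0 ?x0// ltW.
have [/existsP[j /andP[cj /eqP xj]]|] := boolP [exists j, c j && (x j == 0)].
  by rewrite (bigD1 j)//= xj powR0 ?mul0r// gt_eqF.
rewrite negb_exists => /forallP xn0.
have xp j : c j -> 0 < x j.
  by move=> cj; rewrite lt_neqAle x0// andbT eq_sym; have := xn0 j; rewrite cj.
have [j cj] : exists j, c j.
  apply/existsP; move: p_sum1; apply: contra_eqT; rewrite negb_exists => /forallP h.
  by rewrite big_pred0 => [|j]; [rewrite eq_sym oner_eq0|exact/negbTE].
set a := \sum_(j | _) _ in s0 *.
have a0 : 0 < a.
  rewrite /a (bigD1 j)//= ltr_pwDl ?mulr_gt0 ?xp//.
  by apply: sumr_ge0 => i /andP[ci _]; rewrite mulr_ge0 ?x0// ltW.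
have -> : \prod_(j | c j) x j `^ p j = expR (\sum_(j | c j) p j * ln (x j)).
  rewrite expR_sum; apply: eq_bigr => i ci.
  by rewrite /powR gt_eqF// xp.
rewrite -[leRHS]lnK// ler_expR.
have -> : ln a = \sum_(j | c j) p j * (ln a + (x j / a - 1)).
  under eq_bigr do rewrite 2!mulrDr mulrN1 mulrA.
  by rewrite 2!big_split /= sumrN -!mulr_suml -/a p_sum1 mul1r divff ?gt_eqF// subrr addr0.
apply: ler_sum => i ci; rewrite ler_pM2l// -lerBlDl -ln_div ?posrE ?xp//.
have /le_ln1Dx : -1 < x i / a - 1.
  by rewrite -ltrBlDr opprK addNr divr_gt0// xp.
by rewrite addrC subrK.
Qed.

Local Open Scope ereal_scope.

(** With an infinite entry the right-hand side is infinite because all weights are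
positive; otherwise this is [amgm]. *)
Lemma lee_amgm (x : I -> \bar R) : (forall j, c j -> 0 <= x j) ->
  \prod_(j | c j) x j `^ p j <= \sum_(j | c j) (p j)%:E * x j.
Proof.
move=> x0.
have px0 j : c j -> 0 <= (p j)%:E * x j.
  by move=> cj; rewrite mule_ge0 ?x0// lee_fin ltW.
have [/existsP[j /andP[cj /eqP xj]]|] := boolP [exists j, c j && (x j == +oo)].
  rewrite [leRHS](bigD1 j)//=.
  rewrite xj gt0_muley ?lte_fin// addye ?leey//.
  by rewrite gt_eqF// (lt_le_trans (ltNyr 0)) ?sume_ge0// => i /andP[/px0].
rewrite negb_exists => /forallP xoo.
have xE j : c j -> x j = (fine (x j))%:E.
  move=> cj; rewrite fineK// ge0_fin_numE ?x0// ltey.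
  by have := xoo j; rewrite cj.
under eq_bigr => j cj do rewrite xE// poweR_EFin.
under [leRHS]eq_bigr => j cj do rewrite xE// -EFinM.
rewrite prodEFin sumEFin lee_fin; apply: amgm => j cj.
exact/fine_ge0/x0.
Qed.

(** After normalisation of all integrals to 1 this is the integral of [lee_amgm].
A vanishing integral makes the product vanish almost everywhere; otherwise an
infinite integral makes the right-hand side infinite. *)
Lemma lee_holder d (T : measurableType d) (mu : {measure set T -> \bar R})
    (F : I -> T -> \bar R) :
  (forall j, measurable_fun [set: T] (F j)) -> (forall j x, 0 <= F j x) ->
  \int[mu]_x \prod_(j | c j) F j x `^ p j <=
  \prod_(j | c j) (\int[mu]_x F j x) `^ p j.
Proof.
move=> mF F0.
have pn0 j : (p j != 0)%R by rewrite gt_eqF.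
have mFp j : measurable_fun [set: T] (fun x => F j x `^ p j).
  exact: measurable_poweR_comp.
have I0 j : 0 <= \int[mu]_x F j x by exact: integral_ge0.
have [/existsP[j /andP[cj /eqP Ij]]|] :=
    boolP [exists j, c j && (\int[mu]_x F j x == 0)].
  rewrite [leRHS](bigD1 j)//= Ij poweR0r// mul0e.
  rewrite (@ge0_ae_eq_integral _ _ _ _ _ _ (cst 0)) ?integral0//.
  - exact: measurable_prode.
  - by move=> x _; apply: prode_ge0 => i _; exact: poweR_ge0.
  - have : ae_eq mu setT (F j) (cst 0).
      by apply/ae_eq_integral_abs => //; under eq_integral do rewrite gee0_abs//.
    by apply: filterS => x /= /(_ Logic.I) Fx _; rewrite (bigD1 j)//= Fx// poweR0r// mul0e.
rewrite negb_exists => /forallP In0.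
have Ip j : c j -> 0 < \int[mu]_x F j x.
  by move=> cj; rewrite lt0e I0 andbT; have := In0 j; rewrite cj.
have [/existsP[j /andP[cj /eqP Ij]]|] :=
    boolP [exists j, c j && (\int[mu]_x F j x == +oo)].
  rewrite [leRHS](bigD1 j)//= Ij poweRyr// gt0_mulye ?leey//.
  elim/big_ind : _ => // [x y|i /andP[ci _]]; first exact: mule_gt0.
  exact/poweR_gt0/Ip.
rewrite negb_exists => /forallP Ioo.
have IE j : c j -> \int[mu]_x F j x = (fine (\int[mu]_x F j x))%:E.
  move=> cj; rewrite fineK// ge0_fin_numE// ltey.
  by have := Ioo j; rewrite cj.
(* All integrals are now positive and finite: divide every F j by its own. *)
set r := fun j => fine (\int[mu]_x F j x).
have r0 j : c j -> (0 < r j)%R by move=> cj; rewrite -lte_fin -IE// Ip.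
pose K := (\prod_(j | c j) r j `^ p j)%R.
have K0 : (0 < K)%R by apply: prodr_gt0 => j cj; rewrite powR_gt0// r0.
have -> : \prod_(j | c j) (\int[mu]_x F j x) `^ p j = K%:E.
  by rewrite -prodEFin; apply: eq_bigr => j cj; rewrite IE.
have FE x : \prod_(j | c j) F j x `^ p j =
    K%:E * \prod_(j | c j) ((r j)^-1%:E * F j x) `^ p j.
  rewrite -prodEFin -big_split /=; apply: eq_bigr => j cj.
  rewrite -poweR_EFin -poweRM ?muleA -?EFinM ?mulfV ?mul1e ?gt_eqF ?r0//.
    by rewrite lee_fin ltW// r0.
  by rewrite mule_ge0// lee_fin invr_ge0 ltW// r0.
under eq_integral do rewrite FE.
have mr j : measurable_fun setT (fun x => (r j)^-1%:E * F j x).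
  exact: measurable_funeM.
rewrite ge0_integralZl ?lee_fin ?(ltW K0)//; last 2 first.
  by apply: measurable_prode => j; exact: measurable_poweR_comp.
  by move=> x _; apply: prode_ge0 => i _; exact: poweR_ge0.
rewrite -[leRHS]mule1 lee_wpmul2l ?lee_fin ?(ltW K0)//.
have rF0 j x : c j -> 0 <= (r j)^-1%:E * F j x.
  by move=> cj; rewrite mule_ge0// lee_fin invr_ge0 ltW// r0.
pose G j x := if c j then (p j)%:E * ((r j)^-1%:E * F j x) else 0.
have mG j : measurable_fun setT (G j).
  by rewrite /G; case: (c j) => //; exact: measurable_funeM.
apply: (@le_trans _ _ (\int[mu]_x \sum_(j | c j) G j x)).
  apply: ge0_le_integral => //.
  - by move=> x _; apply: prode_ge0 => i _; exact: poweR_ge0.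
  - by apply: measurable_prode => j; exact: measurable_poweR_comp.
  - by under eq_fun do rewrite big_mkcond; apply: emeasurable_sum => j; case: (c j).
  - move=> x _; apply: (le_trans (lee_amgm _)) => [j cj|]; first exact: rF0.
  rewrite le_eqVlt; apply/orP; left; apply/eqP; apply: eq_bigr => j cj.
  by rewrite /G cj.
under eq_integral do rewrite big_mkcond.
rewrite ge0_integral_sum//; last 2 first.
  by move=> j; case: (c j).
  move=> j x _; case: (boolP (c j)) => // cj.
  by rewrite /G cj mule_ge0 ?rF0// lee_fin ltW.
rewrite (eq_bigr (fun j => if c j then (p j)%:E else 0)); last first.
  move=> j _; case: (boolP (c j)) => cj; last by rewrite integral0.
  rewrite /G cj ge0_integralZl//; [|by move=> x _; exact: rF0|by rewrite lee_fin ltW].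
  rewrite ge0_integralZl//; last by rewrite lee_fin invr_ge0 ltW// r0.
  by rewrite IE// -EFinM mulVf ?gt_eqF ?r0// mulr1.
by rewrite -big_mkcond sumEFin p_sum1.
Qed.

End amgm.

(** * Iterated integrals over coordinate subspaces and the Finner inequality *)

Section marginals.
Context {R : realType}.
Local Notation T k := (k.-tuple (measurableTypeR R)).
Local Open Scope ereal_scope.

Lemma measurable_tuple_cons k :
  measurable_fun [set: measurableTypeR R * T k] (@tuple_cons R k).
Proof. exact: measurable_cons. Qed.

Lemma measurable_cons_comp k (f : T k.+1 -> \bar R) :
  measurable_fun [set: T k.+1] f ->
  measurable_fun [set: measurableTypeR R * T k] (fun z => f (tuple_cons z)).
Proof. by move=> mf; exact: (measurableT_comp mf (@measurable_tuple_cons k)). Qed.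

Lemma measurable_cons_fst k (f : T k.+1 -> \bar R) (t : T k) :
  measurable_fun [set: T k.+1] f ->
  measurable_fun [set: measurableTypeR R] (fun x => f (tuple_cons (x, t))).
Proof.
move=> /measurable_cons_comp mf.
exact: (measurableT_comp mf (measurable_pair2 t)).
Qed.

Lemma measurable_cons_snd k (f : T k.+1 -> \bar R) (x : R) :
  measurable_fun [set: T k.+1] f ->
  measurable_fun [set: T k] (fun t => f (tuple_cons (x, t))).
Proof.
move=> /measurable_cons_comp mf.
exact: (measurableT_comp mf (measurable_pair1 x)).
Qed.

Definition marginal (c : bool) k (f : T k.+1 -> \bar R) (t : T k) : \bar R :=
  if c then \int[@lebesgue_measure R]_x f (tuple_cons (x, t))
  else f (tuple_cons (0%R, t)).

(** The integral of f over the coordinate subspace of R^k on which the coordinates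
outside b vanish. Peeling off the first coordinate, both here and in the mask b,
keeps all functions on tuples of one size, whatever the subspaces are, and is the
step of the inductions below. *)
Fixpoint iter_int k (b : nat -> bool) : (T k -> \bar R) -> \bar R :=
  if k is k'.+1 then
    fun f => iter_int (fun i => b i.+1) (marginal (b 0%N) f)
  else fun f => f [tuple].

Lemma tnth_tuple_cons0 k x (t : T k) : tnth (tuple_cons (x, t)) ord0 = x.
Proof. by []. Qed.

Lemma tnth_tuple_consS k x (t : T k) j :
  tnth (tuple_cons (x, t)) (lift ord0 j) = tnth t j.
Proof. by rewrite !(tnth_nth 0%R). Qed.

Definition mask_tuple k (b : nat -> bool) (t : T k) : T k :=
  [tuple if b i then tnth t i else 0%R | i < k].

Lemma mask_tuple_cons k b x (t : T k) :
  mask_tuple b (tuple_cons (x, t)) =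
  tuple_cons (if b 0%N then x else 0%R, mask_tuple (fun i => b i.+1) t).
Proof.
apply: eq_from_tnth => i; rewrite tnth_mktuple.
case: (unliftP ord0 i) => [j ->|->].
  by rewrite !tnth_tuple_consS tnth_mktuple.
by rewrite !tnth_tuple_cons0.
Qed.

Lemma measurable_mask_tuple k b :
  measurable_fun [set: T k] (@mask_tuple k b).
Proof.
apply/measurable_fun_tnthP => i.
rewrite (_ : _ \o _ = fun t => if b i then tnth t i else 0%R); last first.
  by apply/funext => t; exact: tnth_mktuple.
by case: (b i) => //; exact: measurable_tnth.
Qed.

Section marginal_lemmas.
Variables (k : nat) (f : T k.+1 -> \bar R).
Hypothesis f0 : forall t, 0 <= f t.

Lemma marginal_ge0 c t : 0 <= marginal c f t.
Proof. by rewrite /marginal; case: c => //; exact: integral_ge0. Qed.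

Hypothesis mf : measurable_fun [set: T k.+1] f.

Lemma measurable_marginal c : measurable_fun [set: T k] (marginal c f).
Proof.
case: c => /=; last exact: measurable_cons_snd.
have f0' z : 0 <= f (@tuple_cons R k z) by [].
exact: (@measurable_fun_fubini_tonelli_G _ _ _ _ _ (@lebesgue_measure R)
  _ (measurable_cons_comp mf) f0').
Qed.

Lemma integral_tuple_cons :
  \int[lebesgue_tuple k.+1]_t f t =
  \int[lebesgue_tuple k]_t \int[@lebesgue_measure R]_x f (tuple_cons (x, t)).
Proof.
rewrite [LHS]ge0_integral_pushforward//; last exact: measurable_tuple_cons.
have mf' := measurable_cons_comp mf.
have f0' z : 0 <= f (@tuple_cons R k z) by [].
rewrite preimage_setT (fubini_tonelli1 (f \o @tuple_cons R k) mf' f0').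
exact: (fubini_tonelli (f \o @tuple_cons R k) mf' f0').
Qed.

End marginal_lemmas.

Lemma integral_lebesgue_tuple k (f : T k -> \bar R) :
  measurable_fun [set: T k] f -> (forall t, 0 <= f t) ->
  \int[lebesgue_tuple k]_t f t = iter_int xpredT f.
Proof.
elim: k f => [|k IH] f mf f0.
  by rewrite [LHS]integral_dirac// diracT mul1e.
rewrite integral_tuple_cons//= -IH//; first exact: measurable_marginal.
by move=> t; exact: marginal_ge0.
Qed.

Lemma le_iter_int k b (f g : T k -> \bar R) :
  measurable_fun [set: T k] f -> measurable_fun [set: T k] g ->
  (forall t, 0 <= f t) -> (forall t, f t <= g t) -> 
  iter_int b f <= iter_int b g.
Proof.
elim: k b f g => [|k IH] b f g mf mg f0 fg //=.
have g0 t : 0 <= g t by exact: le_trans (fg t).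
apply: IH; try exact: measurable_marginal.
  by move=> t; exact: marginal_ge0.
move=> t; rewrite /marginal; case: (b 0%N) => //.
by apply: ge0_le_integral => //; exact: measurable_cons_fst.
Qed.

End marginals.

Section finner_inequality.
Context {R : realType} {I : finType} (p : I -> R).
Hypothesis p_gt0 : forall j, (0 < p j)%R.
Local Notation T k := (k.-tuple (measurableTypeR R)).
Local Open Scope ereal_scope.

(** Integrating out the first coordinate turns F j into its marginal over that
coordinate if b j contains it, and into its restriction to 0 otherwise; the
former factors are handled by Hoelder's inequality, the latter are constant. *)
Theorem finner_inequality k (b : I -> nat -> bool) (F : I -> T k -> \bar R) :
  (forall i, (i < k)%N -> (\sum_(j | b j i) p j = 1)%R) ->
  (forall j, measurable_fun [set: T k] (F j)) -> (forall j t, 0 <= F j t) ->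
  iter_int xpredT (fun t => \prod_j F j (mask_tuple (b j) t) `^ p j) <=
  \prod_j iter_int (b j) (F j) `^ p j.
Proof.
elim: k b F => [|k IH] b F bp mF F0.
  rewrite le_eqVlt; apply/orP; left; apply/eqP => /=.
  by apply: eq_bigr => j _; rewrite (tuple0 (mask_tuple _ _)).
pose b' j i := b j i.+1.
have mFb j : measurable_fun [set: T k.+1] (fun t => F j (mask_tuple (b j) t) `^ p j).
  apply: measurable_poweR_comp.
  exact: (measurableT_comp (mF j) (measurable_mask_tuple (b j))).
have mP : measurable_fun [set: T k.+1]
    (fun t => \prod_j F j (mask_tuple (b j) t) `^ p j).
  exact: measurable_prode.
have mFm j : measurable_fun [set: T k] (marginal (b j 0%N) (F j)).
  exact: measurable_marginal.
have := IH b' (fun j => marginal (b j 0%N) (F j)) _ mFm _.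
move=> /(_ (fun i => bp i.+1)).
have Fm0 j t : 0 <= marginal (b j 0%N) (F j) t by exact: marginal_ge0.
move=> /(_ Fm0); apply: le_trans => /=.
apply: le_iter_int.
- by apply: measurable_marginal => // t; apply: prode_ge0 => j _; exact: poweR_ge0.
- apply: measurable_prode => j; apply: measurable_poweR_comp.
  exact: (measurableT_comp (mFm j) (measurable_mask_tuple (b' j))).
- by move=> t; apply: marginal_ge0 => // {}t; apply: prode_ge0 => j _; exact: poweR_ge0.
move=> t; rewrite /marginal.
under eq_integral => x _ do
  (under eq_bigr do rewrite mask_tuple_cons; rewrite (bigID (b ^~ 0%N))/=).
have cst0 x : \prod_(j | ~~ b j 0%N) F j (tuple_cons (if b j 0%N then x else 0%R,
    mask_tuple (b' j) t)) `^ p j =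
  \prod_(j | ~~ b j 0%N) F j (tuple_cons (0%R, mask_tuple (b' j) t)) `^ p j.
  by apply: eq_bigr => j /negbTE ->.
have cst1 x : \prod_(j | b j 0%N) F j (tuple_cons (if b j 0%N then x else 0%R,
    mask_tuple (b' j) t)) `^ p j =
  \prod_(j | b j 0%N) F j (tuple_cons (x, mask_tuple (b' j) t)) `^ p j.
  by apply: eq_bigr => j ->.
under eq_integral do rewrite cst0 cst1.
rewrite ge0_integralZr//; first last.
- by apply: prode_ge0 => j _; exact: poweR_ge0.
- by move=> x _; apply: prode_ge0 => j _; exact: poweR_ge0.
- apply: measurable_prode => j; apply: measurable_poweR_comp.
  exact: measurable_cons_fst.
rewrite [leRHS](bigID (b ^~ 0%N))/=.
apply: lee_pmul.
- by apply: integral_ge0 => x _; apply: prode_ge0 => j _; exact: poweR_ge0.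
- by apply: prode_ge0 => j _; exact: poweR_ge0.
- rewrite (eq_bigr (fun j => (\int[@lebesgue_measure R]_x
      F j (tuple_cons (x, mask_tuple (b' j) t))) `^ p j)); last by move=> j ->.
  apply: lee_holder => //; first exact: bp.
  by move=> j; exact: measurable_cons_fst.
- rewrite le_eqVlt; apply/orP; left; apply/eqP.
  by apply: eq_bigr => j /negbTE ->.
Qed.

End finner_inequality.

(** * Affine maps of the line *)

Section affine.
Context {R : realType}.
Notation mu := (@lebesgue_measure R).
Local Open Scope ereal_scope.

Lemma measurable_affine (a b : R) :
  measurable_fun [set: measurableTypeR R]
    (fun x : measurableTypeR R => (a * x + b)%R : measurableTypeR R).
Proof. exact/measurable_funD/measurable_cst/measurable_funM. Qed.

Lemma lebesgue_measure_affine (a b : R) (A : set R) : (0 < a)%R -> measurable A ->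
  mu ((fun x => a * x + b)%R @^-1` A) = (a^-1)%:E * mu A.
Proof.
move=> a0 mA.
pose phi := (fun x : measurableTypeR R => (a * x + b)%R : measurableTypeR R).
pose nu := mscale (NngNum (ltW a0))
  (measure_function_pushforward__canonical__measure_function_Measure
    mu (measurable_affine a b)).
have nuX X : nu X = a%:E * mu (phi @^-1` X) by [].
have nuE : mu A = nu A.
  apply: lebesgue_measure_unique => // _ [[u v]] _ <-.
  rewrite [RHS]nuX (_ : phi @^-1` _ =
      [set` `]((u - b) / a)%R, ((v - b) / a)%R]%R]); last first.
    apply/seteqP; split => x /=; rewrite !in_itv /=;
      by rewrite ltr_pdivrMr// ler_pdivlMr// ltrBlDr lerBrDr mulrC.
  rewrite !lebesgue_measure_itv /= !lte_fin ltr_pM2r ?invr_gt0// ltrD2r.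
  case: ifP => _; last by rewrite mule0.
  rewrite -!EFinD -EFinM -mulrBl mulrC -mulrA mulVf ?gt_eqF// mulr1.
  by congr (_%:E); ring.
by rewrite nuE nuX muleA -EFinM mulVf ?gt_eqF// mul1e.
Qed.

(** By uniqueness the Lebesgue measure is a times its image under an increasing
affine map of slope a; decreasing maps reduce to these by reflection. *)
Lemma integral_affine (a b : R) (f : R -> \bar R) : a != 0%R ->
  measurable_fun [set: measurableTypeR R] f -> (forall x, 0 <= f x) ->
  \int[mu]_x f (a * x + b)%R = (`|a|^-1)%:E * \int[mu]_x f x.
Proof.
move=> a0 mf f0.
wlog ap : a b f a0 mf f0 / (0 < a)%R.
  move=> H; have [an|an|a0'] := ltgtP a 0%R; last by rewrite a0' eqxx in a0.
    have mfN : measurable_fun [set: measurableTypeR R] (fun x => f (- x)%R).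
      by apply: measurableT_comp mf _; exact: oppr_measurable.
    have /= := H (- a)%R (- b)%R (fun x => f (- x)%R).
    rewrite oppr_eq0 normrN => /(_ a0 mfN (fun=> f0 _)).
    rewrite oppr_gt0 => /(_ an).
    under eq_integral do rewrite mulNr -opprD opprK.
    move=> ->; congr (_ * _).
    have -> : \int[mu]_x f (- x)%R =
      \int[pushforward mu (-%R : _ -> measurableTypeR R)]_x f x.
      by rewrite ge0_integral_pushforward.
    by apply: eq_measure_integral => //= A mA _; exact: lebesgue_measureN.
  exact: H.
rewrite gtr0_norm//.
pose nu := measure_function_pushforward__canonical__measure_function_Measure
  mu (measurable_affine a b).
transitivity (\int[nu]_x f x).
  by rewrite [RHS]ge0_integral_pushforward//; exact: measurable_affine.
have ai : (0 <= a^-1)%R by rewrite invr_ge0 ltW.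
rewrite (eq_measure_integral (mscale (NngNum ai) mu)).
  by rewrite ge0_integral_mscale.
by move=> A mA _; exact: lebesgue_measure_affine.
Qed.

End affine.

(** * The Brunn-Minkowski inequality on the line *)

Section brunn_minkowski.
Context {R : realType}.
Notation mu := (@lebesgue_measure R).
Local Open Scope ereal_scope.

Lemma lebesgue_measure_shift (b : R) (A : set R) : measurable A ->
  mu ((fun x => x + b)%R @^-1` A) = mu A.
Proof.
move=> mA; rewrite -[RHS]mul1e -[X in X%:E * _]invr1 -(lebesgue_measure_affine b)//.
by congr mu; apply/funext => x /=; rewrite mul1r.
Qed.

Lemma measurable_shift (b : R) (A : set R) : measurable A ->
  measurable ((fun x => x + b)%R @^-1` A).
Proof.
move=> mA; have := measurable_affine 1 b measurableT mA; rewrite setTI.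
by congr measurable; apply/funext => x /=; rewrite mul1r.
Qed.

Lemma measurable_setI_itv (A : set R) (i : interval R) :
  measurable A -> measurable (A `&` [set` i]).
Proof. by move=> mA; apply: measurableI => //; exact: measurable_itv. Qed.

(** The translates of A j by the points b i (for the i before j in s) and a i (for
the i after j) all lie in C, and they sit in consecutive disjoint intervals. *)
Lemma brunn_minkowski_itv (I : eqType) (s : seq I) (A : I -> set R)
    (a b : I -> R) (C : set R) : uniq s ->
  (forall j, measurable (A j)) -> measurable C ->
  (forall j, A j (a j)) -> (forall j, A j (b j)) ->
  (forall j, (a j <= b j)%R) ->
  (forall x : I -> R, (forall j, A j (x j)) -> C (\sum_(j <- s) x j)%R) ->
  \sum_(j <- s) mu (A j `&` [set` `]a j, b j]%R]) <=
  mu (C `&` [set` `](\sum_(j <- s) a j)%R, (\sum_(j <- s) b j)%R]%R]).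
Proof.
move=> + mA + Aa Ab ab; elim: s C => [|j s IH] C /=.
  by move=> _ _ _; rewrite big_nil.
move=> /andP[js us] mC AC; rewrite !big_cons.
set a' := (\sum_(i <- s) a i)%R; set b' := (\sum_(i <- s) b i)%R.
have ab' : (a' <= b')%R by exact: ler_sum.
(* Cut at b j + a': below it lies a translate of A j, above it a translate of
   the sum of the other sets. *)
rewrite (_ : C `&` _ = (C `&` [set` `](a j + a')%R, (b j + a')%R]%R]) `|`
    (C `&` [set` `](b j + a')%R, (b j + b')%R]%R])); last first.
  rewrite -setIUr; congr (_ `&` _); apply/seteqP; split => x /=; rewrite !in_itv/=.
    by move=> /andP[-> xb]; case: (leP x (b j + a')%R) => h; [left|right].
  move=> [/andP[-> /le_trans]|/andP[h ->]].
    by apply; rewrite lerD2l.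
  by rewrite andbT (le_lt_trans _ h)// lerD2r.
rewrite measureU//; first last.
- rewrite -subset0 => x [[_]] /=; rewrite !in_itv/= => /andP[_ h] [_ /andP[]].
  by rewrite ltNge h.
- exact: measurable_setI_itv.
- exact: measurable_setI_itv.
apply: leeD.
- rewrite -[leRHS](lebesgue_measure_shift a'); last exact: measurable_setI_itv.
  apply: le_measure; rewrite ?inE.
  + exact: measurable_setI_itv.
  + by apply: measurable_shift; exact: measurable_setI_itv.
  + move=> x [Ax]; rewrite /= !in_itv/= => xab; split => /=.
      pose y i := if i == j then x else a i.
      have /AC : forall i, A i (y i).
        by move=> i; rewrite /y; case: eqP => [->|_].
      rewrite big_cons /y eqxx big_seq (eq_bigr a) -?big_seq//.
      by move=> i si; case: eqP => // ij; rewrite -ij si in js.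
    by rewrite ltrD2r lerD2r.
- rewrite -[leRHS](lebesgue_measure_shift (b j)); last exact: measurable_setI_itv.
  rewrite preimage_setI.
  rewrite (_ : _ @^-1` [set` _] = [set` `]a', b']%R]); last first.
    by apply/seteqP; split => x /=; rewrite !in_itv/= ![(b j + _)%R]addrC ltrD2r lerD2r.
  apply: IH => //; first exact: measurable_shift.
  move=> x Ax /=.
  pose y i := if i == j then b j else x i.
  have /AC : forall i, A i (y i).
    by move=> i; rewrite /y; case: eqP => [->|_].
  rewrite big_cons /y eqxx big_seq (eq_bigr x) -?big_seq 1?addrC//.
  by move=> i si; case: eqP => // ij; rewrite -ij si in js.
Qed.

(** Points of A close to its infimum and supremum cut off at most two intervals of
length e. *)
Lemma approx_bounded_itv (A : set R) (k e : R) : measurable A -> A !=set0 ->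
  (forall x, A x -> (`|x| <= k)%R) -> (0 < e)%R ->
  exists a b : R, [/\ A a, A b, (a <= b)%R &
    mu A <= mu (A `&` [set` `]a, b]%R]) + (e + e)%:E].
Proof.
move=> mA A0 Ak e0.
have hiA : has_inf A.
  by split=> //; exists (- k)%R => x /Ak; rewrite ler_norml => /andP[].
have hsA : has_sup A.
  by split=> //; exists k => x /Ak; rewrite ler_norml => /andP[].
have [a0 Aa0 a0l] := inf_adherent e0 hiA.
have [b0 Ab0 b0l] := sup_adherent e0 hsA.
have lA x : A x -> (inf A <= x <= sup A)%R.
  by move=> Ax; rewrite inf_lbound ?sup_ubound//; [case: hsA|case: hiA].
set a := Num.min a0 b0; set b := Num.max a0 b0.
have aa0 : (a <= a0)%R by rewrite ge_min lexx.
have bb0 : (b0 <= b)%R by rewrite le_max lexx orbT.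
exists a, b; split.
- by rewrite /a; case: leP.
- by rewrite /b; case: leP.
- by rewrite /a /b ge_min le_max lexx.
have sub : A `<=` (A `&` [set` `]a, b]%R]) `|`
    ([set` `[inf A, a]%R] `|` [set` `[b, sup A]%R]).
  move=> x Ax; have /andP[h1 h2] := lA _ Ax.
  have [xa|ax] := leP x a; first by right; left; rewrite /= in_itv/= h1.
  have [xb|bx] := leP x b; first by left; split => //=; rewrite in_itv/= ax.
  by right; right; rewrite /= in_itv/= h2 ltW.
have mAab : measurable (A `&` [set` `]a, b]%R]) by exact: measurable_setI_itv.
have mitv (i : interval R) : measurable ([set` i] : set (measurableTypeR R)).
  exact: measurable_itv.
apply: (@le_trans _ _ (mu ((A `&` [set` `]a, b]%R]) `|`
    ([set` `[inf A, a]%R] `|` [set` `[b, sup A]%R])))).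
  apply: le_measure; rewrite ?inE//.
  by apply: measurableU => //; exact: measurableU.
apply: (le_trans (measureU2 _ _ _)) => //; first exact: measurableU.
rewrite leeD2l// (le_trans (measureU2 _ _ _))// EFinD.
have itv_le (u v : R) : (v - u <= e)%R -> mu [set` `[u, v]%R] <= e%:E.
  move=> uv; rewrite lebesgue_measure_itv/=; case: ifP => _.
    by rewrite -EFinB lee_fin.
  by rewrite lee_fin ltW.
by apply: leeD; apply: itv_le; lra.
Qed.

(** C stands for the Minkowski sum, which need not be measurable itself. In
[brunn_minkowski_itv] with extreme points close to the ends of the sets, only
small parts near the ends are lost. *)
Lemma brunn_minkowski (I : eqType) (s : seq I) (A : I -> set R) (k : I -> R)
    (C : set R) : uniq s ->
  (forall j, measurable (A j)) -> measurable C -> (forall j, A j !=set0) ->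
  (forall j x, A j x -> (`|x| <= k j)%R) ->
  (forall x : I -> R, (forall j, A j (x j)) -> C (\sum_(j <- s) x j)%R) ->
  \sum_(j <- s) mu (A j) <= mu C.
Proof.
move=> us mA mC A0 Ak AC; apply/lee_addgt0Pr => e e0.
(* Each set loses at most 2 (e / n). *)
pose n : R := ((size s).+1%:R * 2)%R.
have n0 : (0 < n)%R by rewrite mulr_gt0.
have en0 : (0 < e / n)%R by rewrite divr_gt0.
have /choice[ab abP] : forall j, exists ab : R * R, [/\ A j ab.1, A j ab.2, (ab.1 <= ab.2)%R &
    mu (A j) <= mu (A j `&` [set` `]ab.1, ab.2]%R]) + (e / n + e / n)%:E].
  move=> j; have [a [b []]] := approx_bounded_itv (mA j) (A0 j) (Ak j) en0.
  by exists (a, b).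
apply: (@le_trans _ _ (\sum_(j <- s)
  (mu (A j `&` [set` `](ab j).1, (ab j).2]%R]) + (e / n + e / n)%:E))).
  by apply: lee_sum => j _; have [] := abP j.
rewrite big_split /= leeD//.
  apply: (le_trans (brunn_minkowski_itv us mA mC _ _ _ AC)).
  - by move=> j; have [] := abP j.
  - by move=> j; have [] := abP j.
  - by move=> j; have [] := abP j.
  - by apply: le_measure; rewrite ?inE//; exact: measurable_setI_itv.
rewrite sumEFin lee_fin big_const_seq count_predT iter_addr_0.
rewrite -mulr2n -mulrnA -[leRHS](@divfK _ n) ?gt_eqF// -mulr_natr ler_pM2l//.
by rewrite natrM mulrC /n ler_pM2r// ler_nat.
Qed.

End brunn_minkowski.

(** * Integration over superlevel sets *)

Section layer_cake.
Context {R : realType}.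
Notation mu := (@lebesgue_measure R).
Local Open Scope ereal_scope.

(** The condition 0 < t makes the set empty for all other levels, so that the
integral over the levels in [layer_cake] ranges over the whole line. *)
Definition superlevel (F : R -> \bar R) (t : R) : set R :=
  [set x | (0 < t)%R /\ t%:E < F x].

Lemma lebesgue_measure_itv0 (y : \bar R) : 0 <= y ->
  mu [set t | (0 < t)%R /\ t%:E < y] = y.
Proof.
case: y => [r|_|//].
  rewrite lee_fin => r0.
  rewrite (_ : [set _ | _] = [set` `]0%R, r[%R]); last first.
    by apply/seteqP; split => t /=; rewrite in_itv/= lte_fin; [case=> -> ->|move=> /andP[-> ->]].
  rewrite lebesgue_measure_itv/= lte_fin; case: ltP => [_|r0']; first by rewrite sube0.
  by have -> : r = 0%R by apply/le_anti; rewrite r0 r0'.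
rewrite (_ : [set _ | _] = [set` `]0%R, +oo[%R]); last first.
  by apply/seteqP; split => t /=; rewrite in_itv/= andbT ltry; [case|].
by rewrite lebesgue_measure_itv/= ltry.
Qed.

Section F.
Variable F : R -> \bar R.
Hypothesis mF : measurable_fun [set: measurableTypeR R] F.
Hypothesis F0 : forall x, 0 <= F x.

Let D : set (measurableTypeR R * measurableTypeR R) :=
  [set z | (0 < z.2)%R /\ z.2%:E < F z.1].

Let mD : measurable D.
Proof.
rewrite (_ : D = [set z | (cst 0%R z < z.2)%R] `&` [set z | (EFin \o snd) z < (F \o fst) z])//.
apply: measurableI; rewrite -[X in measurable X]setTI.
- by apply: measurable_fun_ltr => //; exact: measurable_snd.
- apply: emeasurable_fun_lt => //; last exact: measurableT_comp.
  by apply/measurable_EFinP; exact: measurable_snd.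
Qed.

Let xsE x : xsection D x = [set t | (0 < t)%R /\ t%:E < F x].
Proof. by apply/seteqP; split => t; rewrite /xsection /= inE. Qed.

Let ysE t : ysection D t = superlevel F t.
Proof. by apply/seteqP; split => x; rewrite /ysection /= inE. Qed.

Lemma measurable_superlevel t : measurable (superlevel F t).
Proof.
by rewrite -ysE; exact: measurable_ysection.
Qed.

Lemma measurable_superlevel_measure :
  measurable_fun [set: measurableTypeR R] (fun t => mu (superlevel F t)).
Proof.
have := measurable_fun_ysection mu mD; congr measurable_fun.
by apply/funext => t; rewrite /= ysE.
Qed.

Lemma layer_cake : \int[mu]_x F x = \int[mu]_t mu (superlevel F t).
Proof.
have := indic_fubini_tonelli mu mu mD.
rewrite indic_fubini_tonelli_FE// indic_fubini_tonelli_GE//.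
under eq_integral => x _ do rewrite /= xsE lebesgue_measure_itv0//.
by under [RHS]eq_integral => t _ do rewrite /= ysE.
Qed.
End F.
End layer_cake.

(** * The Prekopa-Leindler inequality for several functions *)

Lemma prod_powR (R : realType) (I : finType) (c : pred I) (p : I -> R) (t : R) :
  0 < t -> \prod_(j | c j) t `^ p j = t `^ (\sum_(j | c j) p j).
Proof.
move=> t0; apply: (big_ind2 (fun x y => x = t `^ y)) => //; first by rewrite powRr0.
by move=> x1 x2 y1 y2 -> ->; rewrite powRD// (gt_eqF t0) implybT.
Qed.

Section prekopa.
Context {R : realType} {I : finType} (c : pred I) (p : I -> R).
Hypothesis p_gt0 : forall j, (0 < p j)%R.
Hypothesis p_sum1 : (\sum_(j | c j) p j = 1)%R.
Notation mu := (@lebesgue_measure R).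
Local Open Scope ereal_scope.

Let exists_c : exists j, c j.
Proof.
apply/existsP; move: p_sum1; apply: contra_eqT; rewrite negb_exists => /forallP h.
by rewrite big_pred0 => [|j]; [rewrite eq_sym oner_eq0|exact/negbTE].
Qed.

(** When all maxima are 1, for every 0 < t < 1 the superlevel set of H contains the
sum of the nonempty superlevel sets of the f j, and [brunn_minkowski] applies
level by level. The conclusion is additive; the multiplicative form follows from
it by [lee_amgm]. *)
Lemma prekopa_leindler_normalized (f : I -> R -> R) (k : I -> R) (H : R -> \bar R) :
  (forall j, measurable_fun [set: measurableTypeR R] (f j)) ->
  (forall j x, (0 <= f j x <= 1)%R) ->
  (forall j, exists x, f j x = 1%R) ->
  (forall j x, f j x != 0%R -> (`|x| <= k j)%R) ->
  measurable_fun [set: measurableTypeR R] H -> (forall x, 0 <= H x) ->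
  (forall x : I -> R,
    (\prod_(j | c j) f j (x j) `^ p j)%:E <= H (\sum_(j | c j) x j)%R) ->
  \sum_(j | c j) \int[mu]_x (f j x)%:E <= \int[mu]_x H x.
Proof.
move=> mf f01 f1 fk mH H0 fH.
have f0 j x : 0 <= (EFin \o f j) x by rewrite lee_fin; case/andP: (f01 j x).
have mEf j : measurable_fun [set: measurableTypeR R] (EFin \o f j).
  exact/measurable_EFinP.
rewrite layer_cake//.
under eq_bigr => j _ do rewrite (layer_cake (mEf j) (f0 j)).
rewrite -big_filter -ge0_integral_sum//; last first.
  by move=> j; exact: measurable_superlevel_measure.
apply: ge0_le_integral => //.
- by move=> t _; exact: sume_ge0.
- by apply: emeasurable_sum => j; exact: measurable_superlevel_measure.
- exact: measurable_superlevel_measure.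
move=> t _.
(* Only the levels 0 < t < 1 matter: there all superlevel sets are nonempty. *)
have [t0|t0] := leP t 0%R.
  rewrite big1// => j _; rewrite (_ : superlevel _ _ = set0) ?measure0//.
  by apply/seteqP; split => // x [/=]; rewrite ltNge t0.
have [t1|t1] := leP 1%R t.
  rewrite big1// => j _; rewrite (_ : superlevel _ _ = set0) ?measure0//.
  apply/seteqP; split => // x [_ /=]; rewrite lte_fin ltNge.
  by rewrite (le_trans _ t1)//; case/andP: (f01 j x).
apply: (@brunn_minkowski _ _ _ _ k).
- by rewrite filter_uniq// index_enum_uniq.
- by move=> j; exact: measurable_superlevel.
- exact: measurable_superlevel.
- by move=> j; have [x fx] := f1 j; exists x; split => //=; rewrite fx lte_fin.
- move=> j x [_ /=]; rewrite lte_fin => tf; apply: fk.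
  by rewrite gt_eqF// (lt_trans t0).
- move=> x fx; split => //; rewrite big_filter.
  apply: lt_le_trans (fH _); rewrite lte_fin.
  have -> : t = (\prod_(j | c j) t `^ p j)%R.
    by rewrite prod_powR// p_sum1 powRr1// ltW.
  have [j0 cj0] := exists_c.
  apply: ltr_prod; first by apply/hasP; exists j0 => //; rewrite mem_index_enum.
  move=> j cj; rewrite powR_ge0 /=; apply: gt0_ltr_powR => //.
  + by rewrite nnegrE ltW.
  + by rewrite nnegrE; case/andP: (f01 j (x j)).
  + by have [_] := fx j; rewrite /= lte_fin.
Qed.

End prekopa.

Section approx_from_below.
Context {R : realType}.
Local Open Scope ereal_scope.

Lemma lee_poweR_approx (x N L : \bar R) (q : R) :
  (0 < q)%R -> 0 < x -> 0 <= N -> 0 <= L ->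
  (forall r, (0 < r)%R -> r%:E < x -> (r `^ q)%:E * N <= L) -> x `^ q * N <= L.
Proof.
move=> q0 x0 N0 L0 H.
have [r r0 rx] : exists2 r : R, (0 < r)%R & r%:E < x.
  case: x x0 {H} => [y|_|//]; last by exists 1%R => //; rewrite ltry.
  by rewrite lte_fin => y0; exists (y / 2)%R; rewrite ?lte_fin; lra.
have [->|Nn0] := eqVneq N 0; first by rewrite mule0.
have {}N0 : 0 < N by rewrite lt0e Nn0.
case: N N0 H {Nn0} => [N N0 H|_ H|//]; last first.
  have := H r r0 rx.
  by rewrite gt0_muley ?lte_fin ?powR_gt0// leye_eq => /eqP ->; rewrite leey.
case: L L0 H => [L L0 H|_ _|//]; last by rewrite leey.
rewrite lee_fin in L0; rewrite lte_fin in N0.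
pose z := ((L / N) `^ q^-1)%R.
have LN0 : (0 <= L / N)%R by rewrite divr_ge0// ltW.
have zq : (z `^ q = L / N)%R by rewrite -powRrM mulVf ?gt_eqF// powRr1.
have xz : x <= z%:E.
  rewrite leNgt; apply/negP => zx.
  have [y zy yx] : exists2 y : R, (z < y)%R & y%:E < x.
    case: x zx {x0 H rx} => [y|_|//].
      by rewrite lte_fin => zy; exists ((z + y) / 2)%R; rewrite ?lte_fin; lra.
    by exists (z + 1)%R; rewrite ?ltry// ltrDl.
  have z0 : (0 <= z)%R by exact: powR_ge0.
  have y0 : (0 < y)%R by exact: le_lt_trans zy.
  have := H y y0 yx; rewrite -EFinM lee_fin -ler_pdivlMr// -zq leNgt => /negP; apply.
  by apply: gt0_ltr_powR; rewrite ?nnegrE// ltW.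
have xfin : x = (fine x)%:E.
  by rewrite fineK// ge0_fin_numE ?ltW// (le_lt_trans xz)// ltry.
rewrite xfin poweR_EFin -EFinM lee_fin -ler_pdivlMr// -zq.
apply: ge0_ler_powR; rewrite ?nnegrE.
- exact: ltW.
- by rewrite fine_ge0// ltW.
- exact: powR_ge0.
- by rewrite -lee_fin -xfin.
Qed.

Context {I : finType} (p : I -> R).
Hypothesis p_gt0 : forall j, (0 < p j)%R.

(** One factor after the other. A direct passage to the limit is not available, since
a product of extended reals is not continuous where 0 and +oo meet. *)
Lemma lee_prod_approx (s : seq I) (x : I -> \bar R) (N L : \bar R) :
  uniq s -> (forall j, 0 < x j) -> 0 <= N -> 0 <= L ->
  (forall r : I -> R, (forall j, (0 < r j)%R /\ (r j)%:E < x j) ->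
    (\prod_(j <- s) r j `^ p j)%:E * N <= L) ->
  \prod_(j <- s) x j `^ p j * N <= L.
Proof.
move=> + x0 + L0; elim: s N => [|j s IH] N /=.
  move=> _ N0 H; rewrite big_nil.
  have /choice[r rP] : forall j, exists r : R, (0 < r)%R /\ r%:E < x j.
    move=> j; have := x0 j; case: (x j) => [y|_|//].
      by rewrite lte_fin => y0; exists (y / 2)%R; rewrite lte_fin; split; lra.
    by exists 1%R; rewrite ltry.
  by have := H r rP; rewrite big_nil.
move=> /andP[js us] N0 H; rewrite big_cons -muleA.
have P0 : 0 <= \prod_(i <- s) x i `^ p i * N.
  by rewrite mule_ge0// prode_ge0// => i _; exact: poweR_ge0.
apply: lee_poweR_approx => // r r0 rx.
rewrite muleCA; apply: IH => //.
  by rewrite mule_ge0// lee_fin powR_ge0.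
move=> r' r'x; pose y i := if i == j then r else r' i.
have := H y; rewrite big_cons /y eqxx.
rewrite big_seq (eq_bigr (fun i => r' i `^ p i)%R); last first.
  by move=> i si; case: eqP => // ij; rewrite -ij si in js.
rewrite -big_seq [in X in X -> _]mulrC EFinM -muleA; apply.
by move=> i; case: eqP => [->|].
Qed.

End approx_from_below.

Section simple_approx.
Context {R : realType}.
Notation mu := (@lebesgue_measure R).
Local Open Scope ereal_scope.
Import HBNNSimple.

Lemma seq_has_max (s : seq R) x0 : x0 \in s ->
  exists2 y, y \in s & forall z, z \in s -> (z <= y)%R.
Proof.
elim: s x0 => // a s IH x0 _.
case: s IH => [_|b s IH].
  by exists a; rewrite ?mem_head// => z; rewrite inE => /eqP ->.
have [y ys yP] := IH b (mem_head _ _).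
have [ay|ya] := leP a y.
  by exists y; [rewrite inE ys orbT|move=> z; rewrite inE => /predU1P[->|/yP]].
exists a; rewrite ?mem_head// => z; rewrite inE => /predU1P[->//|/yP zy].
exact: le_trans zy (ltW ya).
Qed.

(** A simple function below a truncation of g to a bounded interval; it attains its
maximum because it has finitely many values. *)
Lemma integral_approx_bounded (g : R -> \bar R) (r : R) :
  measurable_fun [set: measurableTypeR R] g -> (forall x, 0 <= g x) ->
  (0 < r)%R -> r%:E < \int[mu]_x g x ->
  exists (phi : R -> R) (k x0 : R),
    [/\ measurable_fun [set: measurableTypeR R] phi,
        (forall x, 0 <= phi x <= phi x0)%R, (0 < phi x0)%R,
        (forall x, phi x != 0 -> `|x| <= k)%R &
        (forall x, (phi x)%:E <= g x) /\ r%:E < \int[mu]_x (phi x)%:E].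
Proof.
move=> mg g0 r0 rg.
pose F (n : nat) : set R := [set` `[(- n%:R)%R, n%:R]%R].
have mF n : measurable (F n : set (measurableTypeR R)) by exact: measurable_itv.
have FU : \bigcup_n F n = setT.
  rewrite -subTset => x _; exists (Num.truncn `|x|).+1 => //=.
  rewrite /F /= in_itv /= -ler_norml ltW//.
  exact: truncnS_gt.
have ndF : nondecreasing_seq F.
  move=> m n mn; apply/subsetPset => x; rewrite /F /= !in_itv/= -!ler_norml.
  by move=> /le_trans; apply; rewrite ler_nat.
have [n rn] : exists n, r%:E < \int[mu]_(x in F n) g x.
  apply/not_existsP => H.
  have : \int[mu]_x g x <= r%:E.
    have mgF n : measurable_fun (F n : set (measurableTypeR R)) g.
      exact: measurable_funS mg.
    have := @ge0_nondecreasing_set_cvg_integral _ (measurableTypeR R) _ F g mu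
      ndF mF mgF (fun _ _ _ => g0 _).
    rewrite FU => cF; apply: (cvge_le _ cF).
    by apply: nearW => n; rewrite leNgt; exact/negP/H.
  by rewrite leNgt rg.
rewrite integral_mkcond ge0_integralE in rn; last first.
  by move=> x _; exact: erestrict_ge0.
rewrite patch_setT in rn.
have [_ [phi phig <-] rphi] := ereal_sup_gt rn.
have phi0 x : (0 <= phi x)%R by exact: fun_ge0.
have mphi : measurable_fun [set: measurableTypeR R] phi by exact: measurable_funP.
rewrite -[sintegral _ _]/(sintegral mu phi) in rphi.
have rI : r%:E < \int[mu]_x (phi x)%:E.
  by rewrite integral_nnsfun// patch_setT.
have [s sE] : exists s : seq R, range phi = [set` s].
  by apply/finite_seqP; exact: fimfunP.
have phis x : phi x \in s by have : range phi (phi x) by []; rewrite sE.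
have [y ys yP] := seq_has_max (phis 0%R).
have [x0 _ x0y] : range phi y by rewrite sE.
have phile x : (phi x <= phi x0)%R by rewrite x0y; exact: yP.
exists phi, n%:R, x0; split => //.
- by move=> x; rewrite phi0 phile.
- rewrite lt_neqAle phi0 andbT eq_sym; apply: contraPneq rI => phi00.
  rewrite (eq_integral (cst 0)).
    by rewrite integral0 lte_fin ltNge ltW.
  by move=> x _; congr EFin; apply/le_anti; rewrite phi0 -phi00 phile.
- move=> x phix; rewrite leNgt; apply/negP => nx.
  have := phig x; rewrite patchE memNset ?lee_fin; last first.
    by rewrite /F /= in_itv/= -ler_norml; apply/negP; rewrite -ltNge.
  by rewrite leNgt lt_neqAle eq_sym phix phi0.
- split => // x; apply: (le_trans (phig x)).
  by rewrite patchE; case: ifPn.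
Qed.

End simple_approx.

Section ereal_monotone.
Context {R : realType}.
Local Open Scope ereal_scope.

Lemma lee_prode (I : Type) (s : seq I) (c : pred I) (x y : I -> \bar R) :
  (forall j, c j -> 0 <= x j <= y j) ->
  \prod_(j <- s | c j) x j <= \prod_(j <- s | c j) y j.
Proof.
move=> xy; elim: s => [|j s IH]; first by rewrite !big_nil.
rewrite !big_cons; case: ifP => // /xy /andP[x0 xyj].
by apply: lee_pmul => //; apply: prode_ge0 => i /xy /andP[].
Qed.

Lemma lee_poweR (x y : \bar R) (q : R) : (0 <= q)%R -> 0 <= x -> x <= y ->
  x `^ q <= y `^ q.
Proof.
move=> q0 x0 xy; apply: gt0_ler_poweR => //; rewrite in_itv /= leey andbT//.
exact: le_trans xy.
Qed.

End ereal_monotone.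

Section prekopa.
Context {R : realType} {I : finType} (c : pred I) (p : I -> R).
Hypothesis p_gt0 : forall j, (0 < p j)%R.
Hypothesis p_sum1 : (\sum_(j | c j) p j = 1)%R.
Notation mu := (@lebesgue_measure R).
Local Open Scope ereal_scope.

Lemma prekopa_leindler_bounded (phi : I -> R -> R) (x0 : I -> R) (k : I -> R)
    (kappa : R) (h : R -> \bar R) :
  (forall j, measurable_fun [set: measurableTypeR R] (phi j)) ->
  (forall j x, 0 <= phi j x <= phi j (x0 j))%R ->
  (forall j, 0 < phi j (x0 j))%R ->
  (forall j x, phi j x != 0 -> `|x| <= k j)%R ->
  measurable_fun [set: measurableTypeR R] h -> (forall x, 0 <= h x) ->
  (0 < kappa)%R ->
  (forall x : I -> R, (\prod_(j | c j) phi j (x j) `^ p j * kappa)%:E <=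
    h (\sum_(j | c j) p j * x j)%R) ->
  (\prod_(j | c j) (\int[mu]_x (phi j x)%:E) `^ p j) * kappa%:E <= \int[mu]_x h x.
Proof.
move=> mphi phi01 M0 phik mh h0 kappa0 phih.
(* Dividing phi j by its maximum M j makes the maximum 1; stretching its
   argument by p j turns the weighted sum of the points into a plain sum. *)
pose M j := phi j (x0 j).
have Mn0 j : M j != 0%R by rewrite gt_eqF// M0.
have pn0 j : p j != 0%R by rewrite gt_eqF.
pose K := (\prod_(j | c j) M j `^ p j * kappa)%R.
have K0 : (0 < K)%R by rewrite mulr_gt0// prodr_gt0// => j _; rewrite powR_gt0// M0.
pose f j y := ((M j)^-1 * phi j ((p j)^-1 * y + 0))%R.
have mf0 j : measurable_fun [set: measurableTypeR R]
    (fun y => phi j ((p j)^-1 * y + 0))%R.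
  exact: (measurableT_comp (mphi j) (measurable_affine _ _)).
have f0 j x : (0 <= f j x)%R.
  by rewrite mulr_ge0 ?invr_ge0 ?(ltW (M0 j))//; case/andP: (phi01 j ((p j)^-1 * x + 0)%R).
have Ki : (0 <= K^-1)%R by rewrite invr_ge0 ltW.
have := @prekopa_leindler_normalized R I c p p_gt0 p_sum1 f (fun j => p j * k j)%R
  (fun x => (K^-1)%:E * h x).
have -> : \sum_(j | c j) \int[mu]_x (f j x)%:E =
    \sum_(j | c j) (p j)%:E * ((M j)^-1%:E * \int[mu]_x (phi j x)%:E).
  apply: eq_bigr => j cj; rewrite /f.
  under eq_integral do rewrite EFinM.
  have e0 x : 0 <= (EFin \o phi j) x by rewrite lee_fin; case/andP: (phi01 j x).
  have me : measurable_fun [set: measurableTypeR R] (EFin \o phi j).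
    exact/measurable_EFinP.
  rewrite ge0_integralZl//; first last.
  - by rewrite lee_fin invr_ge0 ltW// M0.
  - by move=> x _; exact: e0.
  - exact/measurable_EFinP.
  rewrite (integral_affine 0 (f := EFin \o phi j))//; last by rewrite invr_eq0.
  by rewrite ger0_norm ?invrK 1?muleCA// invr_ge0 ltW.
have -> : \int[mu]_x ((K^-1)%:E * h x) = (K^-1)%:E * \int[mu]_x h x.
  by rewrite ge0_integralZl// lee_fin.
set S := \sum_(j | c j) _ => H.
have {H} SK : S <= (K^-1)%:E * \int[mu]_x h x.
  apply: H.
  - by move=> j; exact: measurable_funM.
  - move=> j x; rewrite f0 /= /f mulrC ler_pdivrMr ?M0// mul1r.
    by case/andP: (phi01 j ((p j)^-1 * x + 0)%R).
  - move=> j; exists (p j * x0 j)%R.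
    by rewrite /f addr0 mulKf// mulVf.
  - move=> j x; rewrite /f mulf_eq0 negb_or => /andP[_ /phik].
    by rewrite addr0 normrM [X in (X * _)%R]gtr0_norm ?invr_gt0// ler_pdivrMl.
  - exact: measurable_funeM.
  - by move=> x; rewrite mule_ge0// lee_fin.
  - move=> x; have := phih (fun j => (p j)^-1 * x j + 0)%R.
    have -> : (\sum_(j | c j) p j * ((p j)^-1 * x j + 0) = \sum_(j | c j) x j)%R.
      by apply: eq_bigr => j _; rewrite addr0 mulVKf.
    rewrite -(lee_pmul2l (x := (K^-1)%:E)) ?lte_fin ?invr_gt0//.
    apply: le_trans; rewrite -EFinM lee_fin -ler_pdivrMl ?invr_gt0// invrK.
    rewrite /K -mulrA [(kappa * _)%R]mulrC mulrA ler_pM2r// -big_split /=.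
    apply: ler_prod => j cj; rewrite mulr_ge0 ?powR_ge0//=.
    rewrite -powRM ?f0 ?(ltW (M0 j))// /f mulrA mulfV// mul1r.
    exact: lexx.
have x0' j : 0 <= (M j)^-1%:E * \int[mu]_x (phi j x)%:E.
  rewrite mule_ge0// ?lee_fin ?invr_ge0 ?(ltW (M0 j))//.
  by apply: integral_ge0 => x _; rewrite lee_fin; case/andP: (phi01 j x).
have := le_trans (lee_amgm p_gt0 p_sum1 (fun j _ => x0' j)) SK.
rewrite -(lee_pmul2l (x := K%:E)) ?lte_fin//.
rewrite [leRHS]muleA -EFinM mulfV ?gt_eqF// mul1e; apply: le_trans.
rewrite /K EFinM -prodEFin -muleA [kappa%:E * _]muleC muleA.
rewrite lee_pmul2r ?lte_fin// -big_split /=.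
rewrite le_eqVlt; apply/orP; left; apply/eqP; apply: eq_bigr => j cj.
rewrite -poweR_EFin -poweRM// ?lee_fin ?(ltW (M0 j))//.
by rewrite muleA -EFinM mulfV// mul1e.
Qed.

(** The factor kappa gathers the functions that do not depend on the variable of
integration; in the dimension induction these are the functions attached to the
sets that miss the current coordinate. All of kappa and the integrals are
approached from below by [lee_prod_approx], which leaves bounded functions of
bounded support. *)
Theorem prekopa_leindler (g : I -> R -> \bar R) (kappa : \bar R) (h : R -> \bar R) :
  (forall j, measurable_fun [set: measurableTypeR R] (g j)) ->
  (forall j x, 0 <= g j x) -> 0 <= kappa ->
  measurable_fun [set: measurableTypeR R] h -> (forall x, 0 <= h x) ->
  (forall x : I -> R, \prod_(j | c j) g j (x j) `^ p j * kappa <=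
    h (\sum_(j | c j) p j * x j)%R) ->
  (\prod_(j | c j) (\int[mu]_x g j x) `^ p j) * kappa <= \int[mu]_x h x.
Proof.
move=> mg g0 kappa0 mh h0 gh.
have ih0 : 0 <= \int[mu]_x h x by exact: integral_ge0.
have ig0 j : 0 <= \int[mu]_x g j x by exact: integral_ge0.
have pn0 j : p j != 0%R by rewrite gt_eqF.
have [->|kn0] := eqVneq kappa 0; first by rewrite mule0.
have [/existsP[j /andP[cj /eqP Ij]]|] :=
    boolP [exists j, c j && (\int[mu]_x g j x == 0)].
  by rewrite (bigD1 j)//= Ij poweR0r// 2!mul0e.
rewrite negb_exists => /forallP In0.
pose X j := if c j then \int[mu]_x g j x else 1.
have X0 j : 0 < X j.
  rewrite /X; have := In0 j; case: (c j) => /= In0j; last exact: lte01.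
  by rewrite lt0e In0j ig0.
have -> : \prod_(j | c j) (\int[mu]_x g j x) `^ p j =
    \prod_(j <- [seq j <- index_enum I | c j]) X j `^ p j.
  by rewrite big_filter; apply: eq_bigr => j cj; rewrite /X cj.
apply: lee_prod_approx => //; first by rewrite filter_uniq// index_enum_uniq.
move=> r rX; rewrite muleC -[kappa]poweRe1//.
apply: lee_poweR_approx => //.
- by rewrite lt0e kn0.
- by rewrite lee_fin prodr_ge0// => j _; exact: powR_ge0.
move=> ka ka0 kak; rewrite powRr1 1?muleC; last exact: ltW.
have /choice[F FP] : forall j, exists F : (R -> R) * (R * R),
    [/\ measurable_fun [set: measurableTypeR R] F.1,
        (forall x, 0 <= F.1 x <= F.1 F.2.1)%R, (0 < F.1 F.2.1)%R,
        (forall x, F.1 x != 0 -> `|x| <= F.2.2)%R &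
        c j -> (forall x, (F.1 x)%:E <= g j x) /\
        (r j)%:E < \int[mu]_x (F.1 x)%:E].
  move=> j; have [r0 rj] := rX j; move: rj; rewrite /X; case: (c j) => rj.
    have [phi [k [y0 [h1 h2 h3 h4 h5]]]] :=
      integral_approx_bounded (mg j) (g0 j) r0 rj.
    by exists (phi, (y0, k)).
  (* For j outside c any bounded function with a positive maximum will do. *)
  exists ((\1_[set 0%R] : R -> R), (0%R, 0%R)); split => //=.
  - by move=> x; rewrite !indicE !classical_sets.in_set1 eqxx; case: eqP; rewrite /= ?ler01 ?lexx.
  - by rewrite indicE classical_sets.in_set1 eqxx.
  - by move=> x; rewrite indicE classical_sets.in_set1; have [->|_] := eqVneq x 0%R; rewrite ?normr0//= eqxx.
have main := @prekopa_leindler_bounded (fun j => (F j).1) (fun j => (F j).2.1)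
  (fun j => (F j).2.2) ka h.
have {main} main :
    (\prod_(j | c j) (\int[mu]_x ((F j).1 x)%:E) `^ p j) * ka%:E <= \int[mu]_x h x.
  apply: main => //.
  - by move=> j; have [] := FP j.
  - by move=> j; have [] := FP j.
  - by move=> j; have [] := FP j.
  - by move=> j; have [] := FP j.
  - move=> x; apply: le_trans (gh x); rewrite EFinM -prodEFin.
    apply: lee_pmul; rewrite ?lee_fin ?(ltW ka0) ?(ltW kak)//.
      by apply: prode_ge0 => j _; rewrite lee_fin powR_ge0.
    apply: lee_prode => j cj; rewrite lee_fin powR_ge0 /= -poweR_EFin.
    have [_ F0 _ _ /(_ cj)[Fg _]] := FP j.
    by apply: lee_poweR (Fg _); [exact: ltW|rewrite lee_fin; case/andP: (F0 (x j))].
apply: le_trans main; rewrite lee_pmul2r ?lte_fin// -big_filter -prodEFin.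
rewrite 2!big_filter; apply: lee_prode => j cj.
rewrite lee_fin powR_ge0 /= -poweR_EFin.
have [r0 _] := rX j; have [_ _ _ _ /(_ cj)[_ rF]] := FP j.
by apply: lee_poweR (ltW rF); [exact: ltW|rewrite lee_fin ltW].
Qed.

End prekopa.

(** * The dual of the Finner inequality *)

Section barthe_inequality.
Context {R : realType} {I : finType} (p : I -> R).
Hypothesis p_gt0 : forall j, (0 < p j)%R.
Local Notation T k := (k.-tuple (measurableTypeR R)).
Local Open Scope ereal_scope.

Definition weighted_sum k (b : I -> nat -> bool) (y : I -> T k) : T k :=
  [tuple (\sum_(j | b j i) p j * tnth (y j) i)%R | i < k].

Lemma weighted_sum_cons k (b : I -> nat -> bool) (x : I -> R) (y : I -> T k) :
  weighted_sum b (fun j => tuple_cons (x j, y j)) =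
  tuple_cons ((\sum_(j | b j 0%N) p j * x j)%R,
              weighted_sum (fun j i => b j i.+1) y).
Proof.
apply: eq_from_tnth => i; rewrite tnth_mktuple.
case: (unliftP ord0 i) => [l ->|->].
  by rewrite tnth_tuple_consS tnth_mktuple; apply: eq_bigr => j _; rewrite tnth_tuple_consS.
by rewrite tnth_tuple_cons0; apply: eq_bigr => j _; rewrite tnth_tuple_cons0.
Qed.

(** For fixed values of the other coordinates, the functions of the first coordinate
satisfy the hypothesis of [prekopa_leindler], whose conclusion is the hypothesis
for the marginals. *)
Theorem barthe_inequality k (b : I -> nat -> bool) (h : T k -> \bar R) (g : I -> T k -> \bar R) :
  (forall i, (i < k)%N -> (\sum_(j | b j i) p j = 1)%R) ->
  (forall j, measurable_fun [set: T k] (g j)) -> (forall j t, 0 <= g j t) ->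
  measurable_fun [set: T k] h -> (forall t, 0 <= h t) ->
  (forall y : I -> T k, \prod_j g j (mask_tuple (b j) (y j)) `^ p j <=
    h (weighted_sum b y)) ->
  \prod_j iter_int (b j) (g j) `^ p j <= iter_int xpredT h.
Proof.
elim: k b h g => [|k IH] b h g bp mg g0 mh h0 gh.
  apply: le_trans (le_trans _ (gh (fun=> [tuple]))) _; last first.
    by rewrite (tuple0 (weighted_sum _ _)).
  rewrite le_eqVlt; apply/orP; left; apply/eqP => /=.
  by apply: eq_bigr => j _; rewrite (tuple0 (mask_tuple _ _)).
pose b' j i := b j i.+1.
apply: (IH b' (marginal true h) (fun j => marginal (b j 0%N) (g j))).
- by move=> i; exact: (bp i.+1).
- by move=> j; exact: measurable_marginal.
- by move=> j t; exact: marginal_ge0.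
- exact: (measurable_marginal _ _ true).
- by move=> t; exact: (marginal_ge0 _ true).
move=> y; rewrite (bigID (b ^~ 0%N))/=.
rewrite (eq_bigr (fun j => (\int[@lebesgue_measure R]_x
    g j (tuple_cons (x, mask_tuple (b' j) (y j)))) `^ p j)); last first.
  by move=> j bj; rewrite /marginal bj.
apply: prekopa_leindler => //.
- exact: bp.
- by move=> j; exact: measurable_cons_fst.
- by apply: prode_ge0 => j _; exact: poweR_ge0.
- exact: measurable_cons_fst.
move=> x; rewrite -weighted_sum_cons.
apply: le_trans (gh _); rewrite [leRHS](bigID (b ^~ 0%N))/=.
apply: lee_pmul.
- by apply: prode_ge0 => j _; exact: poweR_ge0.
- by apply: prode_ge0 => j _; exact: poweR_ge0.
- apply: lee_prode => j bj; rewrite poweR_ge0 /=.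
  by rewrite mask_tuple_cons bj.
- apply: lee_prode => j /negbTE bj; rewrite poweR_ge0 /=.
  by rewrite mask_tuple_cons /marginal bj.
Qed.

End barthe_inequality.

(** * Linear changes of variables in the Lebesgue measure *)

Section affine_maps.
Context {R : realType}.
Local Notation T k := (k.-tuple (measurableTypeR R)).

Definition tuple_of_row k (v : 'rV[R]_k) : T k := [tuple v 0 i | i < k].

Lemma tuple_of_rowK k : cancel (@tuple_of_row k) (@row_of_tuple R k).
Proof. by move=> v; apply/rowP => i; rewrite mxE tnth_mktuple. Qed.

Lemma row_of_tupleK k : cancel (@row_of_tuple R k) (@tuple_of_row k).
Proof. by move=> t; apply: eq_from_tnth => i; rewrite tnth_mktuple mxE. Qed.

(** Vectors are rows, so M acts on the right. *)
Definition tuple_affine k d (M : 'M[R]_(k, d)) (v : 'rV[R]_d) (t : T k) : T d :=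
  tuple_of_row (row_of_tuple t *m M + v).

Lemma tuple_affineM k d e (M : 'M[R]_(k, d)) (N : 'M[R]_(d, e)) v t :
  tuple_affine N v (tuple_affine M 0 t) = tuple_affine (M *m N) v t.
Proof. by rewrite /tuple_affine tuple_of_rowK addr0 mulmxA. Qed.

Lemma measurable_tuple_affine k d (M : 'M[R]_(k, d)) v :
  measurable_fun [set: T k] (tuple_affine M v).
Proof.
apply/measurable_fun_tnthP => i.
rewrite (_ : _ \o _ = fun t => \sum_j tnth t j * M j i + v 0 i); last first.
  apply/funext => t; rewrite /= tnth_mktuple !mxE; congr (_ + _).
  by apply: eq_bigr => j _; rewrite mxE.
apply: measurable_funD => //; apply: measurable_sum => j.
by apply: measurable_funM => //; exact: measurable_tnth.
Qed.

Lemma tuple_of_row_cons k x (v : 'rV[R]_k) :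
  tuple_of_row (row_mx x%:M v : 'rV_(1 + k)) = tuple_cons (x, tuple_of_row v).
Proof.
apply: eq_from_tnth => i; rewrite tnth_mktuple.
case: (unliftP ord0 i) => [l ->|->].
  rewrite tnth_tuple_consS tnth_mktuple.
  by rewrite (_ : lift ord0 l = rshift 1 l) ?row_mxEr//; exact: val_inj.
rewrite tnth_tuple_cons0.
transitivity ((row_mx x%:M v : 'rV_(1 + k)) 0 (lshift k ord0)).
  by congr (row_mx _ _ _ _); exact: val_inj.
by rewrite row_mxEl mxE eqxx.
Qed.

Lemma row_of_tuple_cons k x (t : T k) :
  row_of_tuple (tuple_cons (x, t)) = row_mx x%:M (row_of_tuple t) :> 'rV_(1 + k).
Proof. apply: (can_inj (@tuple_of_rowK k.+1)).
by rewrite tuple_of_row_cons !row_of_tupleK. Qed.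

End affine_maps.

Section linear_change.
Context {R : realType}.
Local Notation T k := (k.-tuple (measurableTypeR R)).
Local Open Scope ereal_scope.

Lemma integral_tuple_cons_swap k (f : T k.+1 -> \bar R) :
  measurable_fun [set: T k.+1] f -> (forall t, 0 <= f t) ->
  \int[lebesgue_tuple k.+1]_t f t =
  \int[@lebesgue_measure R]_x \int[lebesgue_tuple k]_t f (tuple_cons (x, t)).
Proof.
move=> mf f0; rewrite integral_tuple_cons//.
have f0' z : 0 <= f (@tuple_cons R k z) by [].
exact/esym/(fubini_tonelli (f \o @tuple_cons R k) (measurable_cons_comp mf) f0').
Qed.

Definition lower_shear k (c : 'M[R]_(k, 1)) : 'M[R]_(1 + k) :=
  block_mx 1%:M 0%R c 1%:M.

(** For fixed last coordinates the shear translates the first one. *)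
Lemma integral_lower_shear k (c : 'M[R]_(k, 1)) (f : T k.+1 -> \bar R) :
  measurable_fun [set: T k.+1] f -> (forall t, 0 <= f t) ->
  \int[lebesgue_tuple k.+1]_t f (tuple_affine (lower_shear c) 0%R t) =
  \int[lebesgue_tuple k.+1]_t f t.
Proof.
move=> mf f0.
have mfc := measurableT_comp mf
  (measurable_tuple_affine (lower_shear c) 0%R).
rewrite integral_tuple_cons// [RHS]integral_tuple_cons//.
apply: eq_integral => t _.
pose b := (row_of_tuple t *m c) 0%R 0%R.
rewrite -[RHS]mul1e -[X in X%:E * _]invr1 -[X in (X^-1)%:E * _]normr1.
rewrite -(integral_affine b (f := fun x => f (tuple_cons (x, t))))//; last first.
  exact: measurable_cons_fst.
apply: eq_integral => x _; congr f.
rewrite /tuple_affine /lower_shear row_of_tuple_cons mul_row_block addr0 !mulmx1 mulmx0 add0r.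
rewrite -[in RHS](row_of_tupleK t) -tuple_of_row_cons; congr tuple_of_row.
have -> : (x%:M + row_of_tuple t *m c = (1 * x + b)%:M)%R; last by [].
by apply/matrixP => i j; rewrite !ord1 !mxE eqxx mul1r /b mxE.
Qed.

(** Induction on the dimension by block Gaussian elimination on the first row and
column. The translation v is needed to make the induction go through. *)
Theorem integral_tuple_affine k (M : 'M[R]_k) v (f : T k -> \bar R) :
  M \in unitmx -> measurable_fun [set: T k] f -> (forall t, 0 <= f t) ->
  \int[lebesgue_tuple k]_t f (tuple_affine M v t) =
  (`|\det M|^-1)%:E * \int[lebesgue_tuple k]_t f t.
Proof.
elim: k M v f => [|k IH] M v f Mu mf f0.
  rewrite det_mx00 normr1 invr1 mul1e.
  by apply: eq_integral => t _; rewrite (tuple0 t) (tuple0 (tuple_affine _ _ _)).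
(* Integrating the last k coordinates first uses the induction hypothesis for D,
   with a translation that depends on the first coordinate. *)
have upper (a : R) (b : 'M[R]_(1, k)) (D : 'M[R]_k) w g :
    measurable_fun [set: T k.+1] g -> (forall t, 0 <= g t) ->
    a != 0%R -> D \in unitmx ->
    \int[lebesgue_tuple k.+1]_t g (tuple_affine (block_mx a%:M b 0%R D : 'M[R]_(1 + k)) w t) =
    (`|a * \det D|^-1)%:E * \int[lebesgue_tuple k.+1]_t g t.
  move=> mg g0 a0 Du.
  have mgc := measurableT_comp mg
    (measurable_tuple_affine (block_mx a%:M b 0%R D : 'M[R]_(1 + k)) w).
  pose w0 := w 0%R 0%R; pose w' := rsubmx (w : 'rV[R]_(1 + k)%N).
  have gE x t : g (tuple_affine (block_mx a%:M b 0%R D : 'M[R]_(1 + k)) w (tuple_cons (x, t))) =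
      g (tuple_cons ((a * x + w0)%R, tuple_affine D (x *: b + w') t)).
    congr g; rewrite /tuple_affine -tuple_of_row_cons row_of_tuple_cons.
    congr tuple_of_row; rewrite mul_row_block mulmx0 addr0.
    rewrite -[X in (_ + X)%R](hsubmxK (w : 'rV[R]_(1 + k)%N)) add_row_mx.
    have -> : (x%:M *m a%:M + lsubmx (w : 'rV[R]_(1 + k)%N) = (a * x + w0)%:M)%R.
      apply/matrixP => i j; rewrite !ord1 !mxE big_ord1 !mxE eqxx !mulr1n mulrC.
      by congr (_ + w _ _)%R; exact: val_inj.
    by rewrite mul_scalar_mx [(x *: b + _ *m _)%R]addrC -addrA.
  rewrite integral_tuple_cons_swap//.
  under eq_integral => x _.
    under eq_integral => t _ do rewrite gE.
    rewrite (IH D _ (fun t => g (tuple_cons ((a * x + w0)%R, t))))//; last first.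
      exact: measurable_cons_snd.
    over.
  have mG : measurable_fun [set: measurableTypeR R]
      (fun x => \int[lebesgue_tuple k]_t g (tuple_cons (x, t))).
    exact: (@measurable_fun_fubini_tonelli_F _ _ _ _ _ (lebesgue_tuple k)
      (g \o @tuple_cons R k) (measurable_cons_comp mg) (fun=> g0 _)).
  have G0 x : 0 <= \int[lebesgue_tuple k]_t g (tuple_cons (x, t)).
    by apply: integral_ge0 => t _.
  rewrite (integral_affine w0 (f := fun x => (`|\det D|^-1)%:E *
    \int[lebesgue_tuple k]_t g (tuple_cons (x, t))))//; first last.
  - by move=> x; rewrite mule_ge0// lee_fin invr_ge0.
  - exact: measurable_funeM.
  rewrite ge0_integralZl// ?lee_fin ?invr_ge0//.
  by rewrite -integral_tuple_cons_swap// muleA -EFinM -invfM -normrM.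
(* With a pivot, N is a lower shear times a block upper triangular matrix whose
   lower right block is the Schur complement. *)
have main (N : 'M[R]_(1 + k)) w g :
    measurable_fun [set: T k.+1] g -> (forall t, 0 <= g t) ->
    N \in unitmx -> N 0%R 0%R != 0%R ->
    \int[lebesgue_tuple k.+1]_t g (tuple_affine N w t) =
    (`|\det N|^-1)%:E * \int[lebesgue_tuple k.+1]_t g t.
  move=> mg g0 Nu N0.
  pose a := N 0%R 0%R; pose b := ursubmx N; pose c := dlsubmx N.
  pose D := (drsubmx N - a^-1 *: (c *m b))%R.
  pose L := lower_shear (a^-1 *: c).
  pose U := block_mx a%:M b 0%R D : 'M[R]_(1 + k).
  have NE : N = L *m U.
    rewrite /L /lower_shear /U mulmx_block !mul1mx ?mul0mx ?mulmx0 !addr0.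
    rewrite -[LHS]submxK; congr block_mx.
    - apply/matrixP => i j; rewrite !ord1 !mxE eqxx mulr1n /a.
      by congr (N _ _); exact: val_inj.
    - by rewrite -scalemxAl mul_mx_scalar scalerA mulVf// scale1r.
    - by rewrite -scalemxAl /D addrC subrK.
  have dL : \det L = 1%R by rewrite det_lblock !det1 mulr1.
  have dU : \det U = (a * \det D)%R by rewrite det_ublock det_scalar1.
  have dN : \det N = (a * \det D)%R by rewrite NE det_mulmx dL dU mul1r.
  have Du : D \in unitmx.
    by move: Nu; rewrite !unitmxE dN unitrM => /andP[].
  rewrite (eq_integral (fun t => g (tuple_affine U w (tuple_affine L 0%R t)))); last first.
    by move=> t _; rewrite tuple_affineM -NE.
  rewrite (integral_lower_shear (a^-1 *: c)%R (f := g \o tuple_affine U w))//.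
  - by rewrite dN; exact: upper.
  - exact: measurableT_comp mg (measurable_tuple_affine _ _).
  - by move=> t /=.
have [M00|] := eqVneq ((M : 'M[R]_(1 + k)) 0%R 0%R) 0%R; last exact: main.
(* Without a pivot, adding to the first row a row that does not vanish in the
   first column creates one. *)
have [i Mi] : exists i : 'I_k, (M : 'M[R]_(1 + k)) (rshift 1 i) 0%R != 0%R.
  apply/existsP; move: Mu; apply: contraTT; rewrite negb_exists => /forallP Mi.
  rewrite unitmxE (expand_det_col M 0%R) big1 ?unitr0// => j _.
  case: (unliftP ord0 j) => [l ->|->]; last by rewrite M00 mul0r.
  have := Mi l; rewrite negbK => /eqP.
  by rewrite (_ : rshift 1 l = lift ord0 l) => [->|]; [rewrite mul0r|exact: val_inj].
pose e : 'rV[R]_k := delta_mx 0%R i.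
pose S := block_mx 1%:M (- e)%R 0%R 1%:M : 'M[R]_(1 + k).
pose S' := block_mx 1%:M e 0%R 1%:M : 'M[R]_(1 + k).
have SS' : S *m S' = 1%:M.
  rewrite /S /S' mulmx_block !mul1mx !mulmx1 !mul0mx !mulmx0 !addr0 add0r.
  by rewrite subrr -scalar_mx_block.
pose N := (S' *m M : 'M[R]_(1 + k)).
have NE : M = S *m N by rewrite /N mulmxA SS' mul1mx.
have dS' : \det S' = 1%R by rewrite det_ublock !det1 mulr1.
have dN : \det N = \det M by rewrite det_mulmx dS' mul1r.
rewrite (eq_integral (fun t => f (tuple_affine N v (tuple_affine S 0%R t)))); last first.
  by move=> t _; rewrite tuple_affineM -NE.
have mfN : measurable_fun [set: T k.+1] (f \o tuple_affine N v).
  exact: measurableT_comp mf (measurable_tuple_affine _ _).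
have fN0 t : 0 <= (f \o tuple_affine N v) t by rewrite /=.
have := upper 1%R (- e)%R 1%:M 0%R _ mfN fN0 (oner_neq0 R) (unitmx1 R k).
rewrite /= => ->.
rewrite det1 mulr1 normr1 invr1 mul1e -dN; apply: main => //.
  by rewrite unitmxE dN -unitmxE.
have -> : N 0%R 0%R = (M : 'M[R]_(1 + k)) (rshift 1 i) 0%R; last exact: Mi.
have z0 : (0%R : 'I_(1 + k)) = lshift k ord0 by exact: val_inj.
rewrite /N mxE big_split_ord /= big_ord1 -z0 M00 mulr0 add0r.
rewrite (bigD1 i)//= big1 ?addr0 => [|l li].
  by rewrite {1}z0 /S' block_mxEur mxE !eqxx mul1r.
by rewrite {1}z0 /S' block_mxEur mxE (negbTE li) andbF mul0r.
Qed.

End linear_change.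

(** * Borel approximation of functions measurable for the completed measure *)

Section borel_hull.
Context d (T : measurableType d) (R : realType).
Variable mu : {sigma_finite_measure set T -> \bar R}.
Local Open Scope ereal_scope.

(** The intersection of a sequence of countable measurable covers whose total
measures tend to the outer measure of E. *)
Lemma measurable_hull (E : set T) : mu_ext mu E < +oo ->
  exists B, [/\ measurable B, E `<=` B & mu B = mu_ext mu E].
Proof.
move=> Eoo.
have cover n : exists F : (set T)^nat, measurable_cover E F /\
    \sum_(k <oo) mu (F k) < mu_ext mu E + n.+1%:R^-1%:E.
  have : mu_ext mu E \is a fin_num by rewrite ge0_fin_numE// mu_ext_ge0.
  have n0 : (0 < n.+1%:R^-1 :> R)%R by rewrite invr_gt0 ltr0n.
  by move=> /(lb_ereal_inf_adherent n0)[_ [F EF <-] ?]; exists F.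
have /choice[F FP] := cover.
have mF n : measurable (\bigcup_k F n k).
  by apply: bigcupT_measurable => k; have [[]] := FP n.
pose B := \bigcap_n \bigcup_k F n k.
have mB : measurable B by exact: bigcapT_measurable.
have EB : E `<=` B by move=> x Ex n _; have [[_ +] _] := FP n; exact.
exists B; split => //; apply/eqP; rewrite eq_le; apply/andP; split.
  apply/lee_addgt0Pr => e e0.
  have [n ne] : exists n, (n.+1%:R^-1 < e :> R)%R.
    exists (Num.truncn e^-1); rewrite invf_plt ?posrE//.
    exact: truncnS_gt.
  apply: (@le_trans _ _ (mu (\bigcup_k F n k))).
    by apply: le_measure; rewrite ?inE// => x; exact.
  apply: (@le_trans _ _ (\sum_(k <oo) mu (F n k))).
    by apply: measure_sigma_subadditive => // k; have [[]] := FP n.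
  have [_ /ltW /le_trans] := FP n; apply.
  by rewrite leeD2l// lee_fin ltW.
by rewrite -(measurable_mu_extE mu mB); exact: le_mu_ext.
Qed.

Lemma sub_caratheodory_measurable (B : set T) : measurable B ->
  (mu_ext mu).-caratheodory B.
Proof. by move=> mB; apply: sub_caratheodory; exact: sub_sigma_algebra. Qed.

(** On pieces of finite measure, the difference of a hull and the set has outer
measure 0 by additivity, and is itself covered by a null set, namely its hull. *)
Lemma caratheodory_measurableE (E : set T) :
  (mu_ext mu).-caratheodory E ->
  exists B N, [/\ measurable B, measurable N, mu N = 0 &
    forall t, ~ N t -> (E t <-> B t)].
Proof.
move=> cE.
have [F FT Foo] := sigma_finiteT mu.
pose G i := E `&` F i.
have Goo i : mu_ext mu (G i) < +oo.
  have [mFi Fi] := Foo i; apply: le_lt_trans Fi.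
  apply: (@le_trans _ _ (mu_ext mu (F i))); last by rewrite measurable_mu_extE.
  by apply: le_mu_ext; exact: subIsetr.
have /choice[H HP] := fun i => measurable_hull (Goo i).
have null i : mu_ext mu (H i `\` G i) = 0.
  have [mH GH muH] := HP i.
  have cG : (mu_ext mu).-caratheodory (G i).
    apply: caratheodory_measurable_setI => //.
    by apply: sub_caratheodory_measurable; exact: (Foo i).1.
  have muH' : mu_ext mu (H i) = mu_ext mu (G i) by rewrite -muH measurable_mu_extE.
  have := cG (H i); rewrite (setIidr GH) -setDE muH'.
  have fG : mu_ext mu (G i) \is a fin_num by rewrite ge0_fin_numE// mu_ext_ge0.
  by move=> e; rewrite -(addeK (mu_ext mu (H i `\` G i)) fG) [X in X - _]addeC -e subee.
have /choice[N NP] : forall i, exists N, [/\ measurable N, H i `\` G i `<=` N & mu N = 0].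
  by move=> i; have := @measurable_hull (H i `\` G i); rewrite null; apply.
exists (\bigcup_i H i), (\bigcup_i N i); split.
- by apply: bigcupT_measurable => i; have [] := HP i.
- by apply: bigcupT_measurable => i; have [] := NP i.
- apply/eqP; rewrite eq_le measure_ge0 andbT.
  apply: le_trans (measure_sigma_subadditive _ _ _ (@subset_refl _ _)) _.
  + by move=> i; have [] := NP i.
  + by apply: bigcupT_measurable => i; have [] := NP i.
  + by rewrite eseries0// => i _ _; have [] := NP i.
- move=> t Nt; split.
    move=> Et; have [i _ Fi] : (\bigcup_i F i) t by rewrite -FT.
    by exists i => //; have [_ + _] := HP i; apply.
  move=> [i _ Hi]; apply: contrapT => nE; apply: Nt; exists i => //.
  by have [_ + _] := NP i; apply; split => // -[].
Qed.

End borel_hull.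

Section lebesgue_image.
Context {R : realType} {k : nat} {T : pointedType} (h : k.-tuple R -> T)
  (g : T -> k.-tuple R).
Hypothesis hK : cancel h g.
Hypothesis gK : cancel g h.
Local Open Scope ereal_scope.
Local Notation Tk := (k.-tuple (measurableTypeR R)).
Local Notation I := (caratheodory_type (lebesgue_image_outer h)).
Local Notation lam := (@lebesgue_tuple R k).

Lemma caratheodory_preimage (A : set T) :
  (lebesgue_image_outer h).-caratheodory A ->
  (mu_ext lam).-caratheodory (h @^-1` A).
Proof.
move=> cA X; have := cA (g @^-1` X).
rewrite /lebesgue_image_outer !preimage_setI preimage_setC.
by rewrite -comp_preimage (_ : g \o h = id) ?preimage_id//; apply/funext.
Qed.

Lemma measurable_image_inv : measurable_fun [set: I] (g : I -> Tk).
Proof.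
move=> _ B mB; rewrite setTI.
change ((lebesgue_image_outer h).-caratheodory (g @^-1` B)) => X.
have cB := @sub_caratheodory_measurable _ _ _ lam B mB.
have hgK A : h @^-1` (g @^-1` A) = A.
  by apply/seteqP; split => t /=; rewrite hK.
rewrite /lebesgue_image_outer !preimage_setI preimage_setC !hgK.
exact: (cB (h @^-1` X)).
Qed.

Lemma lebesgue_imageE (B : set Tk) : measurable B ->
  lebesgue_image h (g @^-1` B) = lam B.
Proof.
move=> mB; rewrite /lebesgue_image /lebesgue_image_outer.
rewrite -comp_preimage (_ : g \o h = id) ?preimage_id; last exact/funext.
exact: measurable_mu_extE.
Qed.

Lemma integral_lebesgue_image (f : Tk -> \bar R) :
  measurable_fun [set: Tk] f -> (forall t, 0 <= f t) ->
  \int[lebesgue_image h]_x f (g x) = \int[lam]_t f t.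
Proof.
move=> mf f0.
pose nu := measure_function_pushforward__canonical__measure_function_Measure
  (lebesgue_image h) measurable_image_inv.
transitivity (\int[nu]_t f t).
  by rewrite [RHS]ge0_integral_pushforward//; exact: measurable_image_inv.
by apply: eq_measure_integral => A mA _; exact: lebesgue_imageE.
Qed.

Section F.
Variable f : T -> \bar R.
Hypothesis mf : measurable_fun [set: I] f.
Hypothesis f0 : forall x, 0 <= f x.

(** Changing f to a constant on a Borel null set N makes it Borel: N collects the
exceptional sets of all superlevel sets of f at rational levels. The constant is
left free; 0 gives a minorant and +oo a majorant. *)
Lemma borel_representative : exists N : set Tk,
  [/\ measurable N, lam N = 0 &
    forall c, measurable_fun [set: Tk] (fun t => if t \in N then c else f (h t))].
Proof.
(* q enumerates the rational numbers, at which the superlevel sets of f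
   determine f. *)
pose q (n : nat) : R := ratr (odflt 0%R (unpickle n)).
have qP (r : R) (y : \bar R) : r%:E < y -> exists2 n, (r < q n)%R & (q n)%:E < y.
  move=> ry; have [s rs sy] : exists2 s : R, (r < s)%R & s%:E <= y.
    case: y ry => [y|_|//]; first by rewrite lte_fin => ry; exists y.
    by exists (r + 1)%R; rewrite ?ltrDl// leey.
  have [x] := rat_in_itvoo rs; rewrite in_itv/= => /andP[rx xs].
  exists (pickle x); rewrite /q pickleK//=.
  by apply: lt_le_trans sy; rewrite lte_fin.
have /choice[BN BNP] : forall n, exists BN : set Tk * set Tk,
    [/\ measurable BN.1, measurable BN.2, lam BN.2 = 0 &
      forall t, ~ BN.2 t -> ((q n)%:E < f (h t) <-> BN.1 t)].
  move=> n; have mA : measurable ([set: I] `&` [set x | (q n)%:E < f x]).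
    exact: emeasurable_fun_o_infty.
  rewrite setTI in mA.
  have [B [N [mB mN N0 BN]]] := caratheodory_measurableE (caratheodory_preimage mA).
  by exists (B, N).
pose N := \bigcup_n (BN n).2.
have mN : measurable N by apply: bigcupT_measurable => n; have [] := BNP n.
exists N; split => //.
  apply/eqP; rewrite eq_le measure_ge0 andbT.
  apply: le_trans (measure_sigma_subadditive _ _ _ (@subset_refl _ _)) _ => //.
    by move=> n; have [] := BNP n.
  by rewrite eseries0// => n _ _; have [] := BNP n.
move=> c; apply: (measurability _ (ErealGenOInfty.measurableE R)) => // _ [_ [r ->] <-].
rewrite setTI.
rewrite (_ : _ @^-1` _ = (N `&` [set _ | r%:E < c]) `|`
    (\bigcup_(n in [set n | (r < q n)%R]) ((BN n).1 `\` N))); last first.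
  apply/seteqP; split => t /=.
    have [Nt|Nt] := pselect (N t); rewrite ?(mem_set Nt) ?(memNset Nt) in_itv/= andbT => rt.
      by left.
    right; have [n rn nf] := qP _ _ rt; exists n => //; split => //.
    by have [_ _ _ /(_ t)[|h1 _]] := BNP n; [move=> Nn; apply: Nt; exists n|exact: h1].
  move=> [[Nt rc]|[n /= rn [Bt Nt]]].
    by rewrite mem_set// in_itv/= rc.
  rewrite memNset// in_itv/= andbT (@lt_trans _ _ (q n)%:E) ?lte_fin//.
  by have [_ _ _ /(_ t)[|_]] := BNP n; [move=> Nn; apply: Nt; exists n|exact].
apply: measurableU.
  apply: measurableI => //; have [rc|rc] := boolP (r%:E < c).
    by rewrite (_ : [set _ | _] = setT)//; apply/seteqP.
  by rewrite (_ : [set _ | _] = set0)//; apply/seteqP; split => // x /=; exact/negP.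
by apply: bigcup_measurable => n _; apply: measurableD => //; have [] := BNP n.
Qed.

Theorem borel_sandwich : exists f1 f2 : Tk -> \bar R,
  [/\ measurable_fun [set: Tk] f1, measurable_fun [set: Tk] f2,
      (forall t, 0 <= f1 t <= f (h t) /\ f (h t) <= f2 t),
      \int[lam]_t f1 t = \int[lebesgue_image h]_x f x &
      \int[lam]_t f2 t = \int[lebesgue_image h]_x f x].
Proof.
have [N [mN N0 mfN]] := borel_representative.
pose F c t := if t \in N then c else f (h t).
have F0 c t : 0 <= c -> 0 <= F c t by rewrite /F; case: ifP.
have FE c : 0 <= c -> \int[lam]_t F c t = \int[lebesgue_image h]_x f x.
  move=> c0; rewrite -integral_lebesgue_image//; [|exact: mfN|by move=> t; exact: F0].
  apply: ge0_ae_eq_integral => //.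
  - exact: measurableT_comp (mfN c) measurable_image_inv.
  - by move=> x _; exact: F0.
  - exists (g @^-1` N); split.
    + by rewrite -[X in measurable X]setTI; exact: measurable_image_inv.
    + by rewrite -N0; exact: lebesgue_imageE.
    + move=> x /= nx; apply: contrapT => Nx; apply: nx => _.
      by rewrite /F memNset// gK.
exists (F 0), (F +oo); split; try exact: mfN; rewrite ?FE//.
move=> t; rewrite /F; case: ifPn => _; rewrite ?lexx ?leey ?f0//.
Qed.

End F.
End lebesgue_image.

(** * Gram determinants *)

Section linear_algebra.
Context {R : realFieldType}.

Lemma inverse_square_dim k d (A : 'M[R]_(k, d)) (B : 'M[R]_(d, k)) :
  A *m B = 1%:M -> B *m A = 1%:M -> k = d.
Proof.
move=> AB BA; apply/eqP; rewrite -(eqr_nat R).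
by rewrite -(mxtrace1 R k) -(mxtrace1 R d) -AB -BA mxtrace_mulC.
Qed.

Lemma det_gramM k d (A B : 'M[R]_(k, d)) : k = d ->
  \det (A *m A^T) * \det (B *m B^T) = (\det (A *m B^T)) ^+ 2.
Proof.
by move=> kd; subst k; rewrite !det_mulmx !det_tr expr2 mulrACA.
Qed.

Lemma det_gram_ge0 k d (A : 'M[R]_(k, d)) : k = d -> 0 <= \det (A *m A^T).
Proof. by move=> kd; subst k; rewrite det_mulmx det_tr -expr2 sqr_ge0. Qed.

Lemma det_conj k n (Q : 'M[R]_(k, n)) (X : 'M[R]_n) : k = n ->
  Q *m Q^T = 1%:M -> \det (Q *m X *m Q^T) = \det X.
Proof.
move=> kn; subst k => QQ.
by rewrite 2!det_mulmx mulrAC -det_mulmx QQ det1 mul1r.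
Qed.

(** The rows of E form an orthonormal basis of the coordinate subspace of b, so that
E embeds a space R^k isometrically onto that subspace of R^n. *)
Definition selection (b : nat -> bool) k n (E : 'M[R]_(k, n)) :=
  E *m E^T = 1%:M /\ E^T *m E = \matrix_(i, j) ((i == j) && b i)%:R.

Lemma selection_mask n b (v : 'rV[R]_n) k (E : 'M[R]_(k, n)) : selection b E ->
  v *m (E^T *m E) = \row_i (if b i then v 0 i else 0).
Proof.
move=> [_ ->]; apply/rowP => i; rewrite !mxE (bigD1 i)//= big1 ?addr0.
  by rewrite mxE eqxx; case: (b i); rewrite ?mulr1 ?mulr0.
by move=> j ji; rewrite mxE (negbTE ji) mulr0.
Qed.

(** Two orthonormal bases of the same subspace differ by an orthogonal matrix. *)
Lemma selection_rotation b n k k' (E : 'M[R]_(k, n)) (E' : 'M[R]_(k', n)) :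
  selection b E -> selection b E' ->
  [/\ k = k', E = (E *m E'^T) *m E' & (E *m E'^T) *m (E *m E'^T)^T = 1%:M].
Proof.
move=> [EE1 EE2] [EE1' EE2'].
have e : E = (E *m E'^T) *m E' by rewrite -mulmxA EE2' -EE2 mulmxA EE1 mul1mx.
have e' : E' = (E' *m E^T) *m E by rewrite -mulmxA EE2 -EE2' mulmxA EE1' mul1mx.
have h1 : (E *m E'^T) *m (E *m E'^T)^T = 1%:M.
  by rewrite trmx_mul trmxK mulmxA -e.
split => //; apply: (inverse_square_dim h1).
by rewrite trmx_mul trmxK mulmxA -e'.
Qed.

(** The rows of O form an orthonormal basis of the orthogonal complement of the rows
w_k selected by Ec, and V is the dual of W. The rows of E W O^T and E V O^T are
the coordinates of the projections of the other w_k and of their dual vectors;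
these two families are dual to each other, and the volume of all w_k is the
product of the volume of the first ones and of the projections of the others. *)
Lemma gram_complement n a k d (W V : 'M[R]_n) (Ec : 'M[R]_(a, n)) (E : 'M[R]_(k, n))
    (O : 'M[R]_(d, n)) :
  V *m W^T = 1%:M -> E *m E^T = 1%:M -> Ec *m Ec^T = 1%:M -> E *m Ec^T = 0 ->
  E^T *m E + Ec^T *m Ec = 1%:M ->
  O *m O^T = 1%:M -> O *m (Ec *m W)^T = 0 ->
  (forall x : 'rV_n, x *m (Ec *m W)^T = 0 -> x = x *m (O^T *m O)) ->
  let D := E *m W *m O^T in let Y := E *m V *m O^T in
  [/\ k = d,
      \det (Y *m Y^T) * \det (D *m D^T) = 1,
      \det (D *m D^T) * \det ((Ec *m W) *m (Ec *m W)^T) = (\det W) ^+ 2,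
      E *m V = Y *m O &
      W *m O^T = E^T *m D].
Proof.
move=> VW EE EcEc EEc EEcE OO OWc OP D Y.
have WO : W *m O^T = E^T *m D.
  rewrite /D -!mulmxA -[LHS]mul1mx -EEcE mulmxDl -2!mulmxA (mulmxA Ec).
  by rewrite -[(Ec *m W) *m O^T]trmxK trmx_mul trmxK OWc trmx0 mulmx0 addr0.
have OP' m (X : 'M[R]_(m, n)) : X *m (Ec *m W)^T = 0 -> X = X *m (O^T *m O).
  move=> X0; apply/row_matrixP => i; rewrite row_mul; apply: OP.
  by rewrite -row_mul X0 row0.
have EVO : E *m V = Y *m O.
  rewrite /Y -mulmxA; apply: OP'.
  by rewrite trmx_mul mulmxA -(mulmxA E) VW mulmx1.
have YD : Y *m D^T = 1%:M.
  by rewrite /D trmx_mul trmxK mulmxA -EVO trmx_mul mulmxA -(mulmxA E) VW mulmx1.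
have DY : D^T *m Y = 1%:M.
  rewrite /Y !mulmxA.
  have -> : D^T *m E = O *m W^T by rewrite -[LHS]trmxK trmx_mul trmxK -WO trmx_mul trmxK.
  by rewrite -(mulmxA O) (mulmx1C VW) mulmx1.
have kd : k = d := inverse_square_dim YD DY.
have YDD : \det (Y *m Y^T) * \det (D *m D^T) = 1.
  by rewrite det_gramM// YD det1 expr1n.
split => //; subst d.
(* Q is orthogonal. The block triangular matrix N (Q V)^T relates the
   determinant of N, whose square is the Gram determinant of the rows of Ec W,
   to that of V. *)
pose Q := col_mx Ec E.
have QQ : Q *m Q^T = 1%:M.
  rewrite tr_col_mx mul_col_row EE EcEc EEc -[Ec *m E^T]trmxK trmx_mul trmxK EEc.
  by rewrite trmx0 -scalar_mx_block.
have QQ' : Q^T *m Q = 1%:M by rewrite tr_col_mx mul_row_col addrC.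
have akn : (a + k)%N = n := inverse_square_dim QQ QQ'.
pose N := col_mx (Ec *m W) O.
have WV : W *m V^T = 1%:M by rewrite -[LHS]trmxK trmx_mul trmxK VW trmx1.
have NQ : N *m (Q *m V)^T = block_mx 1%:M 0 (O *m (Ec *m V)^T) Y^T.
  rewrite [Q *m V]mul_col_mx tr_col_mx mul_col_row; congr block_mx.
  - by rewrite trmx_mul mulmxA -(mulmxA Ec) WV mulmx1.
  - rewrite trmx_mul mulmxA -(mulmxA Ec) WV mulmx1.
    by rewrite -[LHS]trmxK trmx_mul trmxK EEc trmx0.
  - by rewrite [RHS]trmx_mul trmxK.
have NN : N *m N^T = block_mx ((Ec *m W) *m (Ec *m W)^T) 0 0 1%:M.
  rewrite tr_col_mx mul_col_row OO OWc; congr block_mx.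
  by rewrite -[LHS]trmxK trmx_mul trmxK OWc trmx0.
have QV : \det ((Q *m V) *m (Q *m V)^T) = (\det V) ^+ 2.
  rewrite trmx_mul mulmxA -(mulmxA Q) det_conj// det_mulmx det_tr expr2.
  by [].
have := det_gramM N (Q *m V) akn.
rewrite QV NQ NN det_ublock det1 mulr1 det_lblock det1 mul1r det_tr => gV.
have Y2 : \det (Y *m Y^T) = \det Y ^+ 2 by rewrite det_mulmx det_tr expr2.
have dVW : \det V * \det W = 1 by rewrite -(det_tr W) -det_mulmx VW det1.
move: YDD; rewrite Y2 -gV => h.
set G := \det (Ec *m W *m _) in h gV *; set DD := \det (D *m _) in h *.
have : (\det V * \det W) ^+ 2 * (DD * G) = (G * \det V ^+ 2 * DD) * \det W ^+ 2 by ring.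
by rewrite h dVW expr1n !mul1r.
Qed.

End linear_algebra.

(** * Coordinate subspaces as images of isometries *)

Section selection_of_set.
Context {R : realFieldType} {n : nat} (S : {set 'I_n}).

(** A predicate on all natural numbers, because [iter_int] shifts its mask. *)
Definition index_mask (i : nat) : bool := i \in [seq val j | j in S].

Lemma index_maskE (i : 'I_n) : index_mask i = (i \in S).
Proof.
by rewrite /index_mask (mem_map val_inj) mem_enum.
Qed.

Definition selection_mx : 'M[R]_(#|S|, n) :=
  \matrix_(i, j) (enum_val i == j)%:R.

Lemma row_selection_mx m (W : 'M[R]_(n, m)) i :
  row i (selection_mx *m W) = row (enum_val i) W.
Proof.
apply/rowP => j; rewrite !mxE (bigD1 (enum_val i))//= big1 ?addr0.
  by rewrite !mxE eqxx mul1r.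
by move=> l li; rewrite !mxE eq_sym (negbTE li) mul0r.
Qed.

Lemma selection_mxP : selection index_mask selection_mx.
Proof.
split; apply/matrixP => i j.
  rewrite !mxE (bigD1 (enum_val i))//= big1 ?addr0.
    by rewrite !mxE eqxx mul1r (inj_eq enum_val_inj) eq_sym.
  by move=> l li; rewrite !mxE eq_sym (negbTE li) mul0r.
rewrite !mxE index_maskE.
case: (boolP (i \in S)) => iS; last first.
  rewrite andbF big1// => l _; rewrite !mxE.
  by rewrite (_ : enum_val l == i = false) ?mul0r//; apply: contraNF iS => /eqP <-; exact: enum_valP.
rewrite (bigD1 (enum_rank_in iS i))//= big1 ?addr0.
  by rewrite !mxE enum_rankK_in// eqxx mul1r andbT.
move=> l li; rewrite !mxE (_ : enum_val l == i = false) ?mul0r//.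
by apply: contraNF li => /eqP e; apply/eqP/enum_val_inj; rewrite enum_rankK_in.
Qed.
End selection_of_set.

Lemma selection_mxC (R : realFieldType) n (S : {set 'I_n}) :
  selection_mx S *m (selection_mx (~: S))^T = 0 :> 'M[R]_(_, _).
Proof.
apply/matrixP => i j; rewrite !mxE big1// => l _; rewrite !mxE.
have [<-|_] := eqVneq (enum_val i) l; last by rewrite mul0r.
rewrite (_ : _ == _ = false) ?mulr0//; apply/negbTE/eqP => h.
by have := enum_valP j; rewrite h inE (enum_valP i).
Qed.

Lemma selection_mxD (R : realFieldType) n (S : {set 'I_n}) :
  (selection_mx S)^T *m selection_mx S +
  (selection_mx (~: S))^T *m selection_mx (~: S) = 1%:M :> 'M[R]_n.
Proof.
have [_ ->] := @selection_mxP R _ S; have [_ ->] := @selection_mxP R _ (~: S).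
apply/matrixP => i j; rewrite !mxE !index_maskE inE.
by case: (i == j); case: (i \in S); rewrite /= ?addr0 ?add0r.
Qed.

Section change_of_variables.
Context {R : realType}.
Local Notation T k := (k.-tuple (measurableTypeR R)).
Local Open Scope ereal_scope.

(** The dimensions k and d are only propositionally equal, so D has no determinant;
its absolute value is the square root of a Gram determinant. *)
Lemma integral_tuple_affine_gram k d (D : 'M[R]_(k, d)) (f : T d -> \bar R) :
  k = d -> \det (D *m D^T) != 0%R ->
  measurable_fun [set: T d] f -> (forall t, 0 <= f t) ->
  \int[lebesgue_tuple k]_t f (tuple_affine D 0%R t) =
  ((Num.sqrt (\det (D *m D^T)))^-1)%:E * \int[lebesgue_tuple d]_t f t.
Proof.
move=> kd; subst d => Du mf f0.
have dD : \det (D *m D^T) = (\det D ^+ 2)%R by rewrite det_mulmx det_tr expr2.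
rewrite dD sqrtr_sqr integral_tuple_affine// unitmxE unitfE.
by move: Du; rewrite dD expf_eq0.
Qed.

(** Recursion on n gives a selection adapted to the recursive definition of
[iter_int]; [iter_int_selection] extends the formula to all selections. *)
Lemma exists_selection n (b : nat -> bool) : exists k (E : 'M[R]_(k, n)),
  selection b E /\ forall f : T n -> \bar R, measurable_fun [set: T n] f ->
    (forall t, 0 <= f t) ->
    iter_int b f = \int[lebesgue_tuple k]_t f (tuple_affine E 0%R t).
Proof.
elim: n b => [|n IH] b.
  exists 0%N, 0%R; split; first by split; apply/matrixP => -[].
  move=> f mf f0; rewrite [RHS]integral_dirac// ?diracT ?mul1e /=.
    by rewrite (tuple0 (tuple_affine _ _ _)).
  exact: measurableT_comp mf (measurable_tuple_affine _ _).
have [k [E [[EE1 EE2] IHf]]] := IH (fun i => b i.+1).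
pose Dg : 'M[R]_(1 + n) := (\matrix_(i, j) ((i == j) && b i)%:R)%R.
have bE (A : 'M[R]_(1 + n)) : A = block_mx (b 0%N)%:R%:M 0%R 0%R (E^T *m E) ->
    A = Dg.
  move=> ->; rewrite EE2.
  rewrite -[RHS](submxK Dg); congr block_mx; apply/matrixP => i j.
  - by rewrite !ord1 !mxE !eqxx mulr1n.
  - by rewrite !mxE eq_lrshift.
  - by rewrite !mxE eq_rlshift.
  - by rewrite !mxE eq_rshift.
case b0 : (b 0%N).
  pose F := block_mx 1%:M 0%R 0%R E : 'M[R]_(1 + k, 1 + n).
  have FF : F *m F^T = 1%:M.
    rewrite /F tr_block_mx mulmx_block !trmx0 !mulmx0 !mul0mx !addr0 !add0r trmx1.
    by rewrite mulmx1 EE1 -scalar_mx_block.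
  have FF' : F^T *m F = Dg.
    apply: bE; rewrite /F tr_block_mx mulmx_block !trmx0 !mulmx0 !mul0mx !addr0.
    by rewrite !add0r trmx1 mulmx1 b0.
  exists k.+1, F; split; first by split.
  move=> f mf f0; rewrite /= IHf; last 2 first.
  - exact: measurable_marginal.
  - by move=> t; exact: marginal_ge0.
  have mfF : measurable_fun [set: T k.+1] (f \o tuple_affine F 0%R).
    exact: measurableT_comp mf (measurable_tuple_affine _ _).
  rewrite [RHS](integral_tuple_cons _ mfF)//; last by move=> t /=.
  apply: eq_integral => t _; rewrite /marginal b0; apply: eq_integral => x _ /=.
  congr f; rewrite /tuple_affine -tuple_of_row_cons row_of_tuple_cons !addr0.
  by rewrite mul_row_block mulmx1 !mulmx0 addr0 add0r.
pose F := row_mx 0%R E : 'M[R]_(k, 1 + n).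
have FF : F *m F^T = 1%:M by rewrite /F tr_row_mx mul_row_col mul0mx add0r.
have FF' : F^T *m F = Dg.
  apply: bE; rewrite /F tr_row_mx mul_col_row trmx0 !mulmx0 !mul0mx b0.
  by congr block_mx; apply/matrixP => i j; rewrite !mxE mul0rn.
exists k, F; split; first by split.
move=> f mf f0; rewrite /= IHf; last 2 first.
- exact: measurable_marginal.
- by move=> t; exact: marginal_ge0.
apply: eq_integral => t _; rewrite /marginal b0; congr f.
have tF : row_of_tuple t *m F = row_mx 0%:M (row_of_tuple t *m E) :> 'rV[R]_(1 + n).
  rewrite mul_mx_row mulmx0; congr row_mx.
  by apply/matrixP => i j; rewrite !mxE mul0rn.
by rewrite /tuple_affine -tuple_of_row_cons !addr0 -tF.
Qed.

Lemma iter_int_selection n (b : nat -> bool) k (E : 'M[R]_(k, n)) (f : T n -> \bar R) :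
  selection b E -> measurable_fun [set: T n] f -> (forall t, 0 <= f t) ->
  iter_int b f = \int[lebesgue_tuple k]_t f (tuple_affine E 0%R t).
Proof.
move=> bE mf f0; have [k' [E' [bE' ->]]] := exists_selection n b; rewrite //.
have [kk' EE' EE1] := selection_rotation bE bE'.
have mfE : measurable_fun [set: T k'] (f \o tuple_affine E' 0%R).
  exact: measurableT_comp mf (measurable_tuple_affine _ _).
have := @integral_tuple_affine_gram k k' (E *m E'^T) _ kk' _ mfE _.
rewrite EE1 det1 oner_neq0 sqrtr1 invr1 mul1e => /(_ isT (fun=> f0 _)) <-.
by apply: eq_integral => t _; rewrite /= tuple_affineM -EE'.
Qed.

Lemma lebesgue_tuple_cube k :
  lebesgue_tuple k [set t : T k | forall i, (0 <= tnth t i <= 1)%R] = 1 /\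
  measurable [set t : T k | forall i, (0 <= tnth t i <= 1)%R].
Proof.
elim: k => [|k [IH mIH]].
  rewrite (_ : [set _ | _] = setT); last by rewrite -subTset => t _ -[].
  by split => //; rewrite /= diracT.
have mC : measurable [set t : T k.+1 | forall i, (0 <= tnth t i <= 1)%R].
  rewrite (_ : [set _ | _] = \bigcap_(i in [set: 'I_k.+1])
      ((fun t => tnth t i) @^-1` [set` `[0%R, 1%R]%R])); last first.
    apply/seteqP; split => [t /= h i _|t h i] /=; first by rewrite in_itv/= h.
    by have := h i Logic.I; rewrite /= in_itv.
  apply: fin_bigcap_measurable => // i _; rewrite -[X in measurable X]setTI.
  by apply: measurable_tnth => //; exact: measurable_itv.
split => //.
rewrite /= /lebesgue_tuple_step /pushforward.
rewrite (_ : _ @^-1` _ = [set` `[0%R, 1%R]%R] `*`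
    [set t : T k | forall i, (0 <= tnth t i <= 1)%R]); last first.
  apply/seteqP; split => -[x t] /=.
    move=> h; split; first by have := h ord0; rewrite tnth_tuple_cons0 in_itv.
    by move=> i; have := h (lift ord0 i); rewrite tnth_tuple_consS.
  move=> [+ h] i; rewrite in_itv/=.
  case: (unliftP ord0 i) => [l ->|->]; last by rewrite tnth_tuple_cons0.
  by rewrite tnth_tuple_consS.
rewrite product_measure1E; [|exact: measurable_itv|exact: mIH].
rewrite [X in _ * X]IH mule1.
have -> : 1 = @lebesgue_measure R [set` `[0%R, 1%R]%R]; last by [].
by rewrite lebesgue_measure_itv/= lte_fin ltr01 oppr0 adde0.
Qed.

End change_of_variables.

(** * Orthonormal coordinates and volumes of parallelepipeds *)

Section onb_coordinates.
Context {R : realType} {n : nat}.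
Implicit Types (u v x : 'rV[R]_n) (F : {vspace 'rV[R]_n}).

Lemma dotvE u v : dotv u v = (u *m v^T) 0 0.
Proof. by rewrite mxE; apply: eq_bigr => i _; rewrite mxE. Qed.

Definition onb_mx F : 'M[R]_(size (onb F), n) := \matrix_i (onb F)`_i.

Lemma onb_mx_orthonormal F : onb_mx F *m (onb_mx F)^T = 1%:M.
Proof.
apply/matrixP => i j; rewrite [RHS]mxE -dotv_onb dotvE !mxE.
by apply: eq_bigr => l _; rewrite !mxE.
Qed.

Lemma onb_mx_expand F x : x \in F -> x = x *m ((onb_mx F)^T *m onb_mx F).
Proof.
move=> xF; rewrite {1}(onb_expand xF) (big_nth 0) big_mkord mulmxA.
rewrite [RHS]mulmx_sum_row; apply: eq_bigr => i _.
rewrite rowK; congr (_ *: _); rewrite dotvE !mxE.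
by apply: eq_bigr => l _; rewrite !mxE.
Qed.

Lemma onb_mx_mem F (v : 'rV_(size (onb F))) : v *m onb_mx F \in F.
Proof.
rewrite mulmx_sum_row; apply: memv_suml => i _; apply: memvZ.
rewrite rowK; suff : (onb F)`_i \in span (onb F) by have [_ ->] := onbP F.
exact/memv_span/mem_nth.
Qed.

Lemma val_onb_comb F (t : (size (onb F)).-tuple R) :
  vsval (onb_comb t) = row_of_tuple t *m onb_mx F.
Proof.
rewrite -[RHS](vsprojK (onb_mx_mem _)); congr (vsval (vsproj F _)).
by rewrite mulmx_sum_row; apply: eq_bigr => i _; rewrite rowK mxE.
Qed.

Definition onb_coord F (v : subvs_of F) : (size (onb F)).-tuple R :=
  tuple_of_row (vsval v *m (onb_mx F)^T).

Lemma onb_coordK F : cancel (@onb_coord F) (@onb_comb R n F).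
Proof.
move=> v; apply: val_inj; rewrite /= val_onb_comb tuple_of_rowK -mulmxA.
by rewrite -onb_mx_expand// subvsP.
Qed.

Lemma onb_combK F : cancel (@onb_comb R n F) (@onb_coord F).
Proof.
move=> t; rewrite /onb_coord val_onb_comb -mulmxA onb_mx_orthonormal mulmx1.
exact: row_of_tupleK.
Qed.

(** The difference of x and its projection is orthogonal to every basis vector. *)
Lemma onb_coord_orthproj F x :
  onb_coord (orthproj F x) = tuple_of_row (x *m (onb_mx F)^T).
Proof.
congr tuple_of_row; apply/rowP => i; apply/eqP; rewrite -subr_eq0 -opprB oppr_eq0.
have iF : (onb F)`_i \in F.
  suff : (onb F)`_i \in span (onb F) by have [_ ->] := onbP F.
  exact/memv_span/mem_nth.
have : dotv (x - vsval (orthproj F x)) (onb F)`_i = 0.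
  by have /mem_orthovP := orthproj_orth F x; apply.
rewrite dotvE mulmxBl mxE [X in _ + X]mxE => <-.
by apply/eqP; congr (_ - _); rewrite !mxE; apply: eq_bigr => l _; rewrite !mxE.
Qed.

Lemma mem_orth_mx (X : seq 'rV[R]_n) x m (M : 'M[R]_(m, n)) :
  (forall u, u \in X -> exists i, u = row i M) ->
  x *m M^T = 0 -> x \in orth (span X).
Proof.
move=> XM xM; rewrite /orth mem_orthov_sym; apply/span_subvP => u /XM[i ->].
rewrite mem_orthov1 herm_eq0C /=.
have -> : (dotv x (row i M) = 0) ; last by rewrite eqxx.
by rewrite dotvE rowE trmx_mul mulmxA xM mul0mx mxE.
Qed.

Lemma orth_mx (X : seq 'rV[R]_n) x m (M : 'M[R]_(m, n)) :
  (forall i, row i M \in X) -> x \in orth (span X) -> x *m M^T = 0.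
Proof.
move=> XM /mem_orthovP xX; apply/rowP => i; rewrite [RHS]mxE.
have : dotv x (row i M) = 0 by apply: xX; exact: memv_span.
by rewrite dotvE => <-; rewrite !mxE; apply: eq_bigr => l _; rewrite !mxE.
Qed.

End onb_coordinates.

Section wedge_gram.
Context {R : realType} {n : nat}.
Local Notation T k := (k.-tuple (measurableTypeR R)).

(** In orthonormal coordinates the parallelepiped is the image of the unit cube
under the coordinate matrix D of s, and D D^T is the Gram matrix of s. *)
Lemma wedgeE (s : seq 'rV[R]_n) k (M : 'M[R]_(k, n)) :
  free s -> size s = k -> (forall i : 'I_k, s`_i = row i M) ->
  wedge s = Num.sqrt (\det (M *m M^T)) /\ \det (M *m M^T) != 0.
Proof.
move=> fs sk; subst k => sM.
pose F := span s; pose O := onb_mx F; pose d := size (onb F).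
have OO : O *m O^T = 1%:M := onb_mx_orthonormal F.
have MF (c : 'rV_(size s)) : c *m M \in F.
  rewrite mulmx_sum_row; apply: memv_suml => i _; apply: memvZ.
  by rewrite -sM; exact/memv_span/mem_nth.
pose D := M *m O^T.
have MO : D *m O = M.
  apply/row_matrixP => i; rewrite -mulmxA row_mul -onb_mx_expand//.
  by rewrite rowE.
have Mfree (c : 'rV_(size s)) : c *m M = 0 -> c = 0.
  move=> cM; apply/rowP => i; rewrite [RHS]mxE.
  have /(@freeP _ _ _ (in_tuple s)) indep : free (in_tuple s) by [].
  apply: (indep (c 0)); rewrite -[RHS]cM mulmx_sum_row.
  by apply: eq_bigr => j _; rewrite -sM.
have [X XM] : exists X : 'M[R]_(d, size s), O = X *m M.
  exists (\matrix_(i, j) coord (in_tuple s) j (onb F)`_i).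
  apply/row_matrixP => i; rewrite row_mul rowK mulmx_sum_row.
  rewrite [LHS](@coord_span _ _ _ (in_tuple s)).
    by apply: eq_bigr => j _; rewrite !mxE -sM.
  suff : (onb F)`_i \in span (onb F) by have [_ ->] := onbP F.
  exact/memv_span/mem_nth.
have XD : X *m D = 1%:M by rewrite mulmxA -XM.
have DX : D *m X = 1%:M.
  apply/eqP; rewrite -subr_eq0; apply/eqP/row_matrixP => i; rewrite row0.
  apply: Mfree; rewrite rowE -mulmxA mulmxBl mul1mx -mulmxA -XM MO subrr.
  by rewrite mulmx0.
have kd : size s = d := inverse_square_dim DX XD.
have DD : M *m M^T = D *m D^T.
  by rewrite -{1}MO /D trmx_mul trmxK !mulmxA.
have dD : \det (D *m D^T) != 0.
  have := det_gramM D X^T kd; rewrite trmxK DX det1 expr1n => h.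
  by apply: contra_eq_neq h => ->; rewrite mul0r eq_sym oner_neq0.
have DD_ge0 : 0 <= \det (D *m D^T).
  exact: det_gram_ge0.
rewrite DD; split => //; rewrite /wedge fs.
pose cube := [set t : T (size s) | forall i, 0 <= tnth t i <= 1].
have [cube1 mcube] := @lebesgue_tuple_cube R (size s).
(* In orthonormal coordinates the parallelepiped is the image A of the unit cube
   under D; it is written as a preimage under the inverse X of D. *)
pose A : set (T d) := tuple_affine X 0 @^-1` cube.
have mA : measurable A.
  by rewrite -[X in measurable X]setTI; exact: measurable_tuple_affine.
have -> : lebesgue_subspace F (@parallelepiped R n s) = lebesgue_tuple d A.
  rewrite /lebesgue_subspace /lebesgue_image /lebesgue_image_outer.
  rewrite -measurable_mu_extE//; congr mu_ext.
  apply/seteqP; split => t /=.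
    move=> [c c01]; rewrite val_onb_comb => tc.
    have {}tc : row_of_tuple t = (\row_i c i) *m D.
      rewrite /D mulmxA -[LHS]mulmx1 -OO mulmxA [X in X *m _]tc; congr (_ *m _).
      by rewrite mulmx_sum_row; apply: eq_bigr => i _; rewrite mxE sM.
    move=> i; rewrite /tuple_affine tc -mulmxA DX mulmx1 addr0.
    by rewrite tnth_mktuple mxE.
  move=> h; exists (tnth (tuple_affine X 0 t)) => //.
  rewrite val_onb_comb -/F -/O XM mulmxA mulmx_sum_row.
  by apply: eq_bigr => i _; rewrite sM tnth_mktuple addr0.
have := @integral_tuple_affine_gram R (size s) d D (fun t => (\1_A t)%:E) kd dD.
have -> : (\int[lebesgue_tuple (size s)]_t (\1_A (tuple_affine D 0 t))%:E = 1)%E.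
  have <- : (\int[lebesgue_tuple (size s)]_t (\1_cube t)%:E = 1)%E.
    by rewrite integral_indic// setIT.
  apply: eq_integral => t _; congr (_%:E); rewrite !indicE; congr (_%:R).
  congr (nat_of_bool _); apply/idP/idP; rewrite !inE /A /= tuple_affineM DX.
    by rewrite /tuple_affine mulmx1 addr0 row_of_tupleK.
  by rewrite /tuple_affine mulmx1 addr0 row_of_tupleK.
rewrite integral_indic// setIT => h.
have h1 : measurable_fun [set: T d] (fun t => (\1_A t)%:E : \bar R).
  by apply/measurable_EFinP; exact: measurable_indic.
have h2 t : (0 <= (\1_A t)%:E :> \bar R)%E by rewrite lee_fin.
have := h h1 h2.
set g := Num.sqrt _ => {h} gA.
have g0 : 0 < g by rewrite sqrtr_gt0 lt_neqAle eq_sym dD DD_ge0.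
have -> : lebesgue_tuple d A = g%:E; last by [].
by rewrite -[LHS]mul1e -(@mulfV _ g) ?gt_eqF// EFinM -muleA -gA mule1.
Qed.
End wedge_gram.

(** * A basis, its dual, and the Brascamp-Lieb constant *)

Section constants.
Context {R : realType} {I : finType} (p c g r : I -> R) (D : R).
Hypothesis D_gt0 : 0 < D.
Hypothesis g_gt0 : forall j, 0 < g j.
Hypothesis r_ge0 : forall j, 0 <= r j.
Hypothesis cgD : forall j, c j * g j = D.

Let K : R := (\prod_j g j `^ p j) / D `^ (\sum_j p j - 1).

Lemma prod_scaled_powR (a : I -> R) : (forall j, 0 <= a j) ->
  \prod_j (a j * r j) `^ p j = \prod_j a j `^ p j * \prod_j r j `^ p j.
Proof. by move=> a0; rewrite -big_split; apply: eq_bigr => j _; rewrite powRM. Qed.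

Let prod_g0 : 0 < \prod_j g j `^ p j.
Proof. by apply: prodr_gt0 => j _; rewrite powR_gt0. Qed.

(** In the application D is the volume of the whole basis, g j the volume of the
vectors outside the j-th set, and c j that of the projections of the others. *)
Lemma prod_ratio_powR : \prod_j c j `^ p j = D `^ (\sum_j p j) / \prod_j g j `^ p j.
Proof.
rewrite -prod_powR//; apply: (mulIf (lt0r_neq0 prod_g0)); rewrite divfK ?lt0r_neq0//.
rewrite -big_split; apply: eq_bigr => j _ /=; rewrite -powRM ?cgD// ltW//.
by rewrite -(pmulr_lgt0 _ (g_gt0 j)) cgD.
Qed.

Let c_gt0 j : 0 < c j. Proof. by rewrite -(pmulr_lgt0 _ (g_gt0 j)) cgD. Qed.

Let powD : D `^ (\sum_j p j) = D * D `^ (\sum_j p j - 1).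
Proof. by rewrite -{2}(@powRr1 _ D) ?ltW// -powRD ?(gt_eqF D_gt0) ?implybT// addrC subrK. Qed.

Lemma BL_constant_upper :
  D * \prod_j ((c j)^-1 * r j) `^ p j = K * \prod_j r j `^ p j.
Proof.
rewrite prod_scaled_powR => [|j]; last by rewrite invr_ge0 ltW.
rewrite mulrA; congr (_ * _).
have -> : \prod_j (c j)^-1 `^ p j = (\prod_j c j `^ p j)^-1.
  rewrite -prodfV; apply: eq_bigr => j _.
  by rewrite -powR_inv1 ?ltW// -powRrM mulN1r powRN.
rewrite prod_ratio_powR invf_div /K powD.
have D1 : D `^ (\sum_j p j - 1) != 0 by rewrite gt_eqF// powR_gt0.
by field; rewrite D1 gt_eqF.
Qed.

Lemma BL_constant_lower :
  D^-1 * \prod_j (c j * r j) `^ p j = K^-1 * \prod_j r j `^ p j.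
Proof.
rewrite prod_scaled_powR => [|j]; last exact: ltW.
rewrite mulrA; congr (_ * _); rewrite prod_ratio_powR /K powD.
have D1 : D `^ (\sum_j p j - 1) != 0 by rewrite gt_eqF// powR_gt0.
by field; rewrite D1 !gt_eqF.
Qed.

End constants.

Section frames.
Context {R : realType} {n : nat} (w : 'I_n -> 'rV[R]_n).
Hypothesis hw : basis_of fullv [seq w i | i : 'I_n].

Definition frame_mx : 'M[R]_n := \matrix_i w i.
Definition dual_frame_mx : 'M[R]_n := invmx frame_mx^T.
Local Notation W := frame_mx.
Local Notation V := dual_frame_mx.

Lemma wedge_frame : wedge [seq w i | i : 'I_n] = `|\det W| /\ \det W != 0.
Proof.
have sz : size [seq w i | i : 'I_n] = n by rewrite size_map size_enum_ord.
have [|-> dW] := @wedgeE R n _ n W (basis_free hw) sz.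
  move=> i; rewrite rowK (nth_map i) ?size_enum_ord// nth_ord_enum.
  by [].
move: dW; rewrite det_mulmx det_tr -expr2 sqrtr_sqr expf_eq0 /= => dW.
by split.
Qed.

Lemma dual_frame : V *m W^T = 1%:M.
Proof. by rewrite mulVmx// unitmx_tr unitmxE unitfE; case: wedge_frame. Qed.

Lemma free_subframe (A : {set 'I_n}) : free [seq w k | k in A].
Proof.
have e : perm_eq (map w (enum A ++ enum (~: A))) [seq w i | i : 'I_n].
  apply: perm_map; apply: uniq_perm.
  - rewrite cat_uniq !enum_uniq /= andbT; apply/hasPn => i.
    by rewrite !mem_enum inE.
  - exact: enum_uniq.
  - by move=> i; rewrite mem_cat !mem_enum !inE orbN.
have := basis_free hw; rewrite -(perm_free e) map_cat; exact: catl_free.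
Qed.

Section frame_of_set.
Variable A : {set 'I_n}.
Let H := span [seq w k | k in ~: A].
Local Notation O := (onb_mx (orth H)).
Local Notation E := (selection_mx A : 'M[R]_(_, n)).
Local Notation Ec := (selection_mx (~: A) : 'M[R]_(_, n)).

Let rowEcW i : row i (Ec *m W) = w (enum_val i).
Proof. by rewrite row_selection_mx rowK. Qed.

Let D := E *m W *m O^T.
Let Y := E *m V *m O^T.

Let jac : [/\ #|A| = size (onb (orth H)),
      \det (Y *m Y^T) * \det (D *m D^T) = 1,
      \det (D *m D^T) * \det ((Ec *m W) *m (Ec *m W)^T) = (\det W) ^+ 2,
      E *m V = Y *m O &
      W *m O^T = E^T *m D].
Proof.
have [EE _] := @selection_mxP R n A.
have [EcEc _] := @selection_mxP R n (~: A).
have OW : O *m (Ec *m W)^T = 0.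
  apply/row_matrixP => i; rewrite row_mul row0.
  apply: (@orth_mx _ _ [seq w k | k in ~: A]).
    by move=> j; rewrite rowEcW; apply: map_f; rewrite mem_enum; exact: enum_valP.
  by rewrite rowE; exact: onb_mx_mem.
have OP (x : 'rV[R]_n) : x *m (Ec *m W)^T = 0 -> x = x *m (O^T *m O).
  move=> xW; apply: onb_mx_expand; apply: mem_orth_mx xW => u /mapP[k].
  rewrite mem_enum => kA ->; exists (enum_rank_in kA k).
  by rewrite rowEcW enum_rankK_in.
exact: (gram_complement dual_frame EE EcEc (selection_mxC R A) (selection_mxD R A)
  (onb_mx_orthonormal _) OW OP).
Qed.

Lemma frame_coordinates :
  [/\ #|A| = size (onb (orth H)), E *m V = Y *m O & W *m O^T = E^T *m D].
Proof. by case: jac. Qed.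

Lemma frame_determinants :
  [/\ 0 < wedge [seq w k | k in ~: A], 0 < Num.sqrt (\det (D *m D^T)),
      Num.sqrt (\det (Y *m Y^T)) = (Num.sqrt (\det (D *m D^T)))^-1 &
      Num.sqrt (\det (D *m D^T)) * wedge [seq w k | k in ~: A] = `|\det W|].
Proof.
have [kd YD DW _ _] := jac.
have sz : size [seq w k | k in ~: A] = #|~: A| by rewrite size_map -cardE.
have [|-> dc] := wedgeE (M := Ec *m W) (free_subframe (~: A)) sz.
  move=> i; rewrite rowEcW (nth_map (enum_val i)) -?cardE//.
  by rewrite -enum_val_nth.
have D0 := det_gram_ge0 D kd.
have Dn0 : \det (D *m D^T) != 0.
  by apply: contra_eq_neq YD => ->; rewrite mulr0 eq_sym oner_neq0.
have C0 : 0 <= \det ((Ec *m W) *m (Ec *m W)^T).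
  rewrite -(pmulr_rge0 _ (_ : 0 < \det (D *m D^T))) ?DW ?sqr_ge0//.
  by rewrite lt_neqAle eq_sym Dn0.
have s0 : 0 < Num.sqrt (\det (D *m D^T)).
  by rewrite sqrtr_gt0 lt_neqAle eq_sym Dn0.
split.
- by rewrite sqrtr_gt0 lt_neqAle eq_sym dc.
- exact: s0.
- apply: (mulIf (lt0r_neq0 s0)); rewrite mulVf ?gt_eqF//.
  by rewrite -sqrtrM ?YD ?sqrtr1//; exact: det_gram_ge0.
- by rewrite -sqrtrM// DW sqrtr_sqr.
Qed.

End frame_of_set.
End frames.

(** * The Brascamp-Lieb inequality and its reverse *)

(** The integrand of the first inequality is compared with a Borel majorant without
first showing it measurable: the integral of a nonnegative function is a supremum
over the simple functions below it. *)
Lemma le_integral_dominated d (T : measurableType d) (R : realType)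
    (mu : {measure set T -> \bar R}) (f g : T -> \bar R) :
  (forall x, 0 <= f x)%E -> (forall x, f x <= g x)%E ->
  (\int[mu]_x f x <= \int[mu]_x g x)%E.
Proof.
move=> f0 fg; rewrite !ge0_integralE => [|x _|x _]; [|exact: le_trans (fg x)|by []].
apply: le_ereal_sup => _ [h hf <-]; exists h => // x.
by apply: le_trans (hf x) _; rewrite !patch_setT.
Qed.

Section brascamp_lieb.
Context {R : realType} {n m : nat} (w : 'I_n -> 'rV[R]_n).
Hypothesis hw : basis_of fullv [seq w i | i : 'I_n].
Variables (S : 'I_m -> {set 'I_n}) (p : 'I_m -> R).
Hypothesis hS : uniform_cover S p.
Local Notation W := (frame_mx w).
Local Notation V := (dual_frame_mx w).
Local Notation F j := (orth (Htilde w S j)).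
Local Notation O j := (onb_mx (F j)).
Local Notation E j := (selection_mx (S j) : 'M[R]_(_, n)).
Local Notation T k := (k.-tuple (measurableTypeR R)).

Let b j := index_mask (S j).

Let p_gt0 j : 0 < p j. Proof. by case: hS. Qed.

Let sum_b i : (i < n)%N -> \sum_(j | b j i) p j = 1.
Proof.
move=> ilt; have [_ /(_ (Ordinal ilt)) <-] := hS.
rewrite big_mkcond; apply: eq_bigr => j _.
rewrite -[X in b j X]/(val (Ordinal ilt)) /b index_maskE.
by case: ifP; rewrite ?mulr1 ?mulr0.
Qed.

Let row_mask j (t : T n) : row_of_tuple (mask_tuple (b j) t) =
  row_of_tuple t *m ((E j)^T *m E j).
Proof.
rewrite (selection_mask _ (selection_mxP (S j))); apply/rowP => i.
by rewrite !mxE tnth_mktuple.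
Qed.

Let coords j : [/\ #|S j| = size (onb (F j)),
   E j *m V = (E j *m V *m (O j)^T) *m O j &
   W *m (O j)^T = (E j)^T *m (E j *m W *m (O j)^T)].
Proof. exact: frame_coordinates. Qed.

Let c j := Num.sqrt (\det ((E j *m W *m (O j)^T) *m (E j *m W *m (O j)^T)^T)).
Let g j := wedge (outside w S j).

Let dets j : [/\ 0 < g j, 0 < c j,
   Num.sqrt (\det ((E j *m V *m (O j)^T) *m (E j *m V *m (O j)^T)^T)) = (c j)^-1 &
   c j * g j = `|\det W| ].
Proof. exact: frame_determinants. Qed.

Let dW : \det W != 0. Proof. by case: (wedge_frame hw). Qed.

Let BL1E : BL1 w S p = (\prod_j g j `^ p j) / `|\det W| `^ (\sum_j p j - 1).
Proof. by rewrite /BL1; have [-> _] := wedge_frame hw. Qed.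

Let det_gram_neq0 k d (D : 'M[R]_(k, d)) :
  0 < Num.sqrt (\det (D *m D^T)) -> \det (D *m D^T) != 0.
Proof. by rewrite sqrtr_gt0 => /lt0r_neq0. Qed.

Section upper.
Variable f : forall j, subvs_of (F j) -> R.
Arguments f : clear implicits.
Hypothesis f_ge0 : forall j x, 0 <= f j x.
Hypothesis f_int : forall j, (lebesgue_subspace (F j)).-integrable setT (EFin \o f j).

Lemma brascamp_lieb_upper :
  (\int[lebesgue_rV R n]_x (\prod_(j < m) f j (orthproj (F j) x) `^ p j)%:E
   <= (BL1 w S p * \prod_(j < m)
        (\int[lebesgue_subspace (F j)]_x f j x) `^ p j)%:E)%E.
Proof.
pose I j := (\int[lebesgue_subspace (F j)]_x f j x)%R.
have I_ge0 j : 0 <= I j by apply: fine_ge0; apply: integral_ge0 => x _; rewrite lee_fin.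
have sandwich j : exists G : T (size (onb (F j))) -> \bar R,
    [/\ measurable_fun [set: T (size (onb (F j)))] G, (forall t, 0 <= G t)%E,
        (forall v, (f j v)%:E <= G (onb_coord v))%E &
        (\int[lebesgue_tuple (size (onb (F j)))]_t G t = (I j)%:E)%E].
  have f0 v : (0 <= (EFin \o f j) v)%E by rewrite lee_fin.
  have [f1 [G [_ mG fG _ GE]]] := borel_sandwich (@onb_combK R n (F j))
    (@onb_coordK R n (F j)) (measurable_int _ (f_int j)) f0.
  exists G; split => //.
  - by move=> t; have [/andP[h1 h2] h3] := fG t; exact: le_trans (le_trans h1 h2) h3.
  - by move=> v; have [_] := fG (onb_coord v); rewrite onb_coordK.
  - by rewrite GE /Rintegral fineK// integrable_fin_num.
have [G GP] : exists G : forall j, T (size (onb (F j))) -> \bar R, forall j,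
    [/\ measurable_fun [set: T (size (onb (F j)))] (G j), (forall t, 0 <= G j t)%E,
        (forall v, (f j v)%:E <= G j (onb_coord v))%E &
        (\int[lebesgue_tuple (size (onb (F j)))]_t G j t = (I j)%:E)%E].
  exists (fun j => projT1 (cid (sandwich j))) => j.
  exact: projT2 (cid (sandwich j)).
pose Phi j : T n -> \bar R := G j \o tuple_affine (W *m (O j)^T) 0.
pose Psi (t : T n) : \bar R := (\prod_j G j (tuple_affine (O j)^T 0 t) `^ p j)%E.
have mPhi j : measurable_fun [set: T n] (Phi j).
  by have [mG _ _ _] := GP j; exact: measurableT_comp mG (measurable_tuple_affine _ _).
have Phi0 j t : (0 <= Phi j t)%E by have [_ G0 _ _] := GP j; exact: G0.
have mPsi : measurable_fun [set: T n] Psi.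
  apply: measurable_prode => j; apply: measurable_poweR_comp.
  by have [mG _ _ _] := GP j; exact: measurableT_comp mG (measurable_tuple_affine _ _).
have Psi0 t : (0 <= Psi t)%E by apply: prode_ge0 => j _; exact: poweR_ge0.
apply: (@le_trans _ _ (\int[lebesgue_rV R n]_x Psi (tuple_of_row x))%E).
  apply: le_integral_dominated => x.
    by rewrite lee_fin prodr_ge0// => j _; exact: powR_ge0.
  rewrite -prodEFin; apply: lee_prode => j _.
  rewrite lee_fin powR_ge0 /= -poweR_EFin; apply: lee_poweR.
  - exact: ltW.
  - by rewrite lee_fin.
  - have [_ _ fG _] := GP j; apply: le_trans (fG _) _.
    by rewrite onb_coord_orthproj /tuple_affine tuple_of_rowK addr0.
rewrite (integral_lebesgue_image (@row_of_tupleK R n) mPsi Psi0).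
have W0 : 0 < `|\det W| by rewrite normr_gt0.
(* The change of variables x = sum_i s_i w_i. *)
have -> : (\int[lebesgue_tuple n]_t Psi t =
    `|\det W|%:E * \int[lebesgue_tuple n]_t Psi (tuple_affine W 0 t))%E.
  rewrite integral_tuple_affine ?unitmxE ?unitfE//.
  by rewrite muleA -EFinM mulfV ?gt_eqF// mul1e.
have -> : (\int[lebesgue_tuple n]_t Psi (tuple_affine W 0 t) =
    iter_int xpredT (fun t => \prod_j Phi j (mask_tuple (b j) t) `^ p j))%E.
  rewrite integral_lebesgue_tuple; last 2 first.
  - exact: measurableT_comp mPsi (measurable_tuple_affine _ _).
  - by move=> t; exact: Psi0.
  congr iter_int; apply/funext => t; apply: eq_bigr => j _; congr (G j _ `^ _)%E.
  have [_ _ WO] := coords j.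
  have EWO : (E j)^T *m E j *m (W *m (O j)^T) = W *m (O j)^T.
    by rewrite {1}WO mulmxA -(mulmxA (E j)^T) (selection_mxP (S j)).1 mulmx1 -WO.
  by rewrite tuple_affineM /tuple_affine row_mask -(mulmxA (row_of_tuple t)) EWO.
have Phi_int j : iter_int (b j) (Phi j) = ((c j)^-1 * I j)%:E.
  rewrite (iter_int_selection (selection_mxP (S j)) (mPhi j) (Phi0 j)).
  have [mG G0 _ GE] := GP j; have [kd _ _] := coords j; have [_ c0 _ _] := dets j.
  rewrite EFinM -GE -(integral_tuple_affine_gram kd (det_gram_neq0 c0) mG G0).
  by apply: eq_integral => t _; rewrite /Phi /= tuple_affineM mulmxA.
apply: (@le_trans _ _ (`|\det W|%:E * \prod_j iter_int (b j) (Phi j) `^ p j)%E).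
  by rewrite lee_pmul2l ?lte_fin//; exact: finner_inequality.
under eq_bigr do rewrite Phi_int poweR_EFin.
rewrite prodEFin -EFinM lee_fin BL1E.
rewrite (@BL_constant_upper R _ p c g I)//.
- by move=> j; have [] := dets j.
- by move=> j; have [] := dets j.
Qed.
End upper.

Section lower.
Variables (f : 'rV[R]_n -> R) (f' : forall j, subvs_of (F j) -> R).
Arguments f' : clear implicits.
Hypothesis f_ge0 : forall x, 0 <= f x.
Hypothesis f_int : (lebesgue_rV R n).-integrable setT (EFin \o f).
Hypothesis f'_ge0 : forall j x, 0 <= f' j x.
Hypothesis f'_int : forall j, (lebesgue_subspace (F j)).-integrable setT (EFin \o f' j).
Hypothesis ff' : forall (x : 'rV[R]_n) (y : forall j, subvs_of (F j)),
  x = \sum_(j < m) p j *: vsval (y j) -> f x >= \prod_(j < m) f' j (y j) `^ p j.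

Lemma brascamp_lieb_lower :
  \int[lebesgue_rV R n]_x f x >= (BL1 w S p)^-1 * \prod_(j < m)
    (\int[lebesgue_subspace (F j)]_x f' j x) `^ p j.
Proof.
pose I j := (\int[lebesgue_subspace (F j)]_x f' j x)%R.
have I_ge0 j : 0 <= I j by apply: fine_ge0; apply: integral_ge0 => x _; rewrite lee_fin.
have sandwich j : exists G : T (size (onb (F j))) -> \bar R,
    [/\ measurable_fun [set: T (size (onb (F j)))] G, (forall t, 0 <= G t)%E,
        (forall v, G (onb_coord v) <= (f' j v)%:E)%E &
        (\int[lebesgue_tuple (size (onb (F j)))]_t G t = (I j)%:E)%E].
  have f0 v : (0 <= (EFin \o f' j) v)%E by rewrite lee_fin.
  have [G [f2 [mG _ fG GE _]]] := borel_sandwich (@onb_combK R n (F j))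
    (@onb_coordK R n (F j)) (measurable_int _ (f'_int j)) f0.
  exists G; split => //.
  - by move=> t; have [/andP[]] := fG t.
  - by move=> v; have [/andP[_]] := fG (onb_coord v); rewrite onb_coordK.
  - by rewrite GE /Rintegral fineK// integrable_fin_num.
have [G GP] : exists G : forall j, T (size (onb (F j))) -> \bar R, forall j,
    [/\ measurable_fun [set: T (size (onb (F j)))] (G j), (forall t, 0 <= G j t)%E,
        (forall v, G j (onb_coord v) <= (f' j v)%:E)%E &
        (\int[lebesgue_tuple (size (onb (F j)))]_t G j t = (I j)%:E)%E].
  exists (fun j => projT1 (cid (sandwich j))) => j.
  exact: projT2 (cid (sandwich j)).
have f0 x : (0 <= (EFin \o f) x)%E by rewrite lee_fin.
have [f1 [h [_ mh fh _ hE]]] := borel_sandwich (@row_of_tupleK R n)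
  (@tuple_of_rowK R n) (measurable_int _ f_int) f0.
have h0 t : (0 <= h t)%E.
  by have [/andP[h1 h2] h3] := fh t; exact: le_trans (le_trans h1 h2) h3.
pose Phi j : T n -> \bar R := G j \o tuple_affine (V *m (O j)^T) 0.
pose H : T n -> \bar R := h \o tuple_affine V 0.
have mPhi j : measurable_fun [set: T n] (Phi j).
  by have [mG _ _ _] := GP j; exact: measurableT_comp mG (measurable_tuple_affine _ _).
have Phi0 j t : (0 <= Phi j t)%E by have [_ G0 _ _] := GP j; exact: G0.
have mH : measurable_fun [set: T n] H.
  exact: measurableT_comp mh (measurable_tuple_affine _ _).
have H0 t : (0 <= H t)%E by exact: h0.
have Phi_int j : iter_int (b j) (Phi j) = (c j * I j)%:E.
  rewrite (iter_int_selection (selection_mxP (S j)) (mPhi j) (Phi0 j)).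
  have [mG G0 _ GE] := GP j; have [kd _ _] := coords j; have [_ c0 YD _] := dets j.
  have Y0 := det_gram_neq0 (D := E j *m V *m (O j)^T).
  rewrite YD invr_gt0 in Y0.
  have := integral_tuple_affine_gram kd (Y0 c0) mG G0.
  rewrite YD invrK EFinM -GE => <-.
  by apply: eq_integral => t _; rewrite /Phi /= tuple_affineM mulmxA.
have VW : `|\det V| = `|\det W|^-1.
  have W0 : `|\det W| != 0 by rewrite normr_eq0.
  apply: (mulIf W0); rewrite mulVf// -normrM -(det_tr W) -det_mulmx.
  by rewrite dual_frame// det1 normr1.
have V0 : \det V != 0 by rewrite -normr_eq0 VW invr_eq0 normr_eq0.
have main : (\prod_j iter_int (b j) (Phi j) `^ p j <= iter_int xpredT H)%E.
  apply: barthe_inequality => // y.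
  (* u j is the point of the j-th subspace whose coordinates on the dual basis
     are those of y j with index in S j. *)
  pose u j : subvs_of (F j) := onb_comb (tuple_affine (V *m (O j)^T) 0 (mask_tuple (b j) (y j))).
  have uE j : vsval (u j) = row_of_tuple (mask_tuple (b j) (y j)) *m V.
    rewrite val_onb_comb tuple_of_rowK addr0 row_mask -!mulmxA.
    congr (_ *m (_ *m _)); have [_ EV _] := coords j.
    by rewrite [RHS]EV -!mulmxA.
  have xE : row_of_tuple (weighted_sum p b y) *m V = \sum_j p j *: vsval (u j).
    under eq_bigr do rewrite uE scalemxAl.
    rewrite -mulmx_suml; congr (_ *m _); apply/rowP => i.
    rewrite summxE !mxE tnth_mktuple big_mkcond; apply: eq_bigr => j _.
    by rewrite !mxE tnth_mktuple; case: ifP => //; rewrite mulr0.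
  apply: (@le_trans _ _ (\prod_j f' j (u j) `^ p j)%:E).
    rewrite -prodEFin; apply: lee_prode => j _; rewrite poweR_ge0 /= -poweR_EFin.
    apply: lee_poweR; [exact: ltW|exact: Phi0|].
    have [_ _ fG _] := GP j; apply: le_trans (fG _).
    by rewrite /u onb_combK.
  apply: (@le_trans _ _ (f (row_of_tuple (weighted_sum p b y) *m V))%:E).
    by rewrite lee_fin; exact: ff'.
  have [_] := fh (tuple_affine V 0 (weighted_sum p b y)).
  by rewrite tuple_of_rowK addr0.
have hH : (iter_int xpredT H = (`|\det W| * \int[lebesgue_rV R n]_x f x)%:E)%E.
  rewrite -integral_lebesgue_tuple// /H /= integral_tuple_affine ?unitmxE ?unitfE//.
  rewrite VW invrK hE EFinM /Rintegral fineK//; exact: integrable_fin_num.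
move: main; under eq_bigr do rewrite Phi_int poweR_EFin.
rewrite prodEFin hH lee_fin BL1E -ler_pdivrMl ?normr_gt0//.
rewrite (@BL_constant_lower R _ p c g I)//.
- by rewrite normr_gt0.
- by move=> j; have [] := dets j.
- by move=> j; have [] := dets j.
Qed.
End lower.

End brascamp_lieb.

Theorem theorem1p2 (R : realType) (n m : nat) (hm : (0 < m)%N)
    (w : 'I_n -> 'rV[R]_n) (hw : basis_of fullv [seq w i | i : 'I_n])
    (S : 'I_m -> {set 'I_n}) (p : 'I_m -> R) (hS : uniform_cover S p) :
  (forall f : forall j, subvs_of (orth (Htilde w S j)) -> R,
     (forall j x, 0 <= f j x) ->
     (forall j, (lebesgue_subspace (orth (Htilde w S j))).-integrable setT
                  (EFin \o f j)) ->
     (\int[lebesgue_rV R n]_x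
        (\prod_(j < m) f j (orthproj (orth (Htilde w S j)) x) `^ p j)%:E
      <= (BL1 w S p * \prod_(j < m)
           (\int[lebesgue_subspace (orth (Htilde w S j))]_x f j x) `^ p j)%:E)%E)
  /\
  (forall (f : 'rV[R]_n -> R) (g : forall j, subvs_of (orth (Htilde w S j)) -> R),
     (forall x, 0 <= f x) ->
     (lebesgue_rV R n).-integrable setT (EFin \o f) ->
     (forall j x, 0 <= g j x) ->
     (forall j, (lebesgue_subspace (orth (Htilde w S j))).-integrable setT
                  (EFin \o g j)) ->
     (forall (x : 'rV[R]_n) (y : forall j, subvs_of (orth (Htilde w S j))),
        x = \sum_(j < m) p j *: vsval (y j) ->
        f x >= \prod_(j < m) g j (y j) `^ p j) ->
     \int[lebesgue_rV R n]_x f x >=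
       (BL1 w S p)^-1 * \prod_(j < m)
         (\int[lebesgue_subspace (orth (Htilde w S j))]_x g j x) `^ p j).
Proof.
split; first exact: brascamp_lieb_upper.
exact: brascamp_lieb_lower.
Qed.
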